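(* There exist an absolute constant $c>0$ and a deterministic algorithm such that, for every chaining functional $h$ of log-concave type with $|h'(1)|=1$ (left derivative), given a probability measure $\rho$ on an $n$-point metric space $(X,d)$, the algorithm finds, in $O(n^2\log n)$ time, a chaining tree $\mathcal C$ for $(X,d)$ such that $$\mathsf{val}_h(\mathcal C)\;\le\;c\;\gamma_h(\rho,X).$$
   Context: $B(x,r)=\{y\in X: d(x,y)\le r\}$. The metric space is given by its pairwise distances; arithmetic operations and evaluations of $h$ have unit cost. Chaining functional: let $f:[0,\infty)\to[0,\infty)$ be a continuous, non-increasing probability density on $[0,\infty)$ and let $F(s)=\int_s^\infty f(t)\,dt$. The chaining functional induced by $f$ is $h(p)=F^{-1}(p)$ for $p\in(0,1]$ (so $h(1)=0$ and $h$ is strictly decreasing and convex). It is of log-concave type if $f$ is log-concave. The normalization $|h'(1)|=1$ is equivalent to $f(0)=1$. We read $h(0)=\lim_{p\to0^+}h(p)\in(0,\infty]$. For a probability measure $\rho$ on $X$, $\gamma_h(\rho,X)=\sup_{x\in X}\int_0^\infty h(\rho(B(x,r)))\,dr$. Chaining tree: a chaining tree $\mathcal C$ for $(X,d)$ is a rooted spanning tree on the vertex set $X$, with root $w\in X$, together with probability labels $p_e\in(0,1/2)$ for each edge $e\in E[\mathcal C]$ such that $\sum_{e\in E[\mathcal C]}p_e\le 1/2$. The length of an edge $e=\{u,v\}$ is $l_e=d(u,v)\,h(p_e)$. For $x\in X$ let $\mathcal P_x$ be the unique path from $x$ to the root; then $\mathsf{val}_h(\mathcal C)=\max_{x\in X}\sum_{e\in\mathcal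 P_x}l_e$. *)

(* Defs.v *)
From HB Require Import structures.
From mathcomp Require Import all_boot all_order all_algebra.
From mathcomp Require Import all_classical all_reals all_analysis.
Set Implicit Arguments.
Unset Strict Implicit.
Unset Printing Implicit Defensive.
Import Order.TTheory GRing.Theory Num.Theory.
Import numFieldNormedType.Exports.
Local Open Scope classical_set_scope.
Local Open Scope ring_scope.

Section ChainingFunctional.
Variable R : realType.
Implicit Types (f h : R -> R) (s p x l : R).

(* Only the values of [f] on [0, +oo[ matter. *)
Definition chaining_density f : Prop :=
  [/\ forall s, 0 <= s -> 0 <= f s,
      {within `[0, +oo[, continuous f},
      forall s t, 0 <= s -> s <= t -> f t <= f s
    & (\int[lebesgue_measure]_(t in `[0%R, +oo[) (f t)%:E = 1)%E].

Definition tail f s : \bar R :=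
  (\int[lebesgue_measure]_(t in `[s, +oo[) (f t)%:E)%E.

(* [h] is F^-1 on ]0, 1], where F is the tail of [f]: as [f] is non-increasing,
   F is injective on the nonnegative reals at which it is positive, so the
   values of [h] on ]0, 1] are determined.  The values of [h] elsewhere are
   junk. *)
Definition induced_by h f : Prop :=
  forall p, 0 < p -> p <= 1 -> 0 <= h p /\ tail f (h p) = p%:E.

Definition log_concave f : Prop :=
  forall s t a, 0 <= s -> 0 <= t -> 0 <= a -> a <= 1 ->
    f s `^ a * f t `^ (1 - a) <= f (a * s + (1 - a) * t).

Definition log_concave_chaining_functional h : Prop :=
  exists f, [/\ chaining_density f, induced_by h f & log_concave f].

Definition has_left_derivative h x l : Prop :=
  (h p - h x) / (p - x) @[p --> x^'-] --> l.

(* [h] on [0, 1], with h(0) the limit of [h] at 0 from the right. *)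
Definition ext0 h p : \bar R :=
  if p == 0 then lim ((h q)%:E @[q --> 0^'+]) else (h p)%:E.

End ChainingFunctional.

Section FiniteMetric.
Variables (R : realType) (X : finType).
Implicit Types (d : X -> X -> R) (rho : X -> R).

Definition is_metric d : Prop :=
  [/\ forall x y, 0 <= d x y,
      forall x y, d x y = 0 <-> x = y,
      forall x y, d x y = d y x
    & forall x y z, d x z <= d x y + d y z].

(* A probability measure on a finite set, given by its point masses. *)
Definition is_probability rho : Prop :=
  (forall x, 0 <= rho x) /\ \sum_x rho x = 1.

Definition mass rho (A : {set X}) : R := \sum_(x in A) rho x.

Definition cball d (x : X) (r : R) : {set X} := [set y | d x y <= r]%SET.

Definition gamma_h (h : R -> R) d rho : \bar R :=
  ereal_sup (range (fun x : X =>
    \int[lebesgue_measure]_(r in `[0%R, +oo[)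
      ext0 h (mass rho (cball d x r))))%E.

(* Edges are two-element sets of vertices; the labels of sets that are not
   edges are irrelevant. *)
Record labelled_graph := LabelledGraph {
  tree_root : X;
  edges : {set {set X}};
  label : {set X} -> R }.

Implicit Type C : labelled_graph.

Definition adj C : rel X := [rel u v | [set u; v]%SET \in edges C].

Definition is_spanning_tree C : Prop :=
  [/\ forall e, e \in edges C -> #|e| = 2%N,
      forall u v, connect (adj C) u v
    & forall c : seq X, ucycle (adj C) c -> (size c < 3)%N].

Definition is_chaining_tree C : Prop :=
  [/\ is_spanning_tree C,
      forall e, e \in edges C -> 0 < label C e < 2^-1
    & \sum_(e in edges C) label C e <= 2^-1].

(* [x :: s] is a simple path from [x] to the root. *)
Definition is_root_path C (x : X) (s : seq X) : Prop :=
  [/\ path (adj C) x s, last x s = tree_root C & uniq (x :: s)].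

Definition root_path C (x : X) : seq X :=
  xget [::] [set s | is_root_path C x s].

Definition edge_length h d C (u v : X) : R := d u v * h (label C [set u; v]%SET).

Definition path_length h d C (x : X) : R :=
  \sum_(e <- zip (x :: root_path C x) (root_path C x)) edge_length h d C e.1 e.2.

(* The root contributes 0, so the default value of the maximum is harmless. *)
Definition val_h h d C : R := \big[Num.max/0]_(x : X) path_length h d C x.

End FiniteMetric.

(* Programs for a real random access machine with an oracle for [h].  The
   memory consists of integer arrays and real arrays, named by natural numbers
   and indexed by natural numbers computed at run time.  A program contains no
   real constants besides natural numbers, cannot round a real number to an
   integer, and a single program serves all input sizes. *)

Inductive iexp :=
  | IConst of nat
  | IGet of nat & iexp
  | IAdd of iexp & iexp
  | ISub of iexp & iexp
  | IMul of iexp & iexp.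

Inductive rexp :=
  | RConst of nat
  | RGet of nat & iexp
  | RAdd of rexp & rexp
  | RSub of rexp & rexp
  | RMul of rexp & rexp
  | RDiv of rexp & rexp
  | RH of rexp.

Inductive bexp :=
  | BLeI of iexp & iexp
  | BLeR of rexp & rexp
  | BNot of bexp
  | BAnd of bexp & bexp.

Inductive cmd :=
  | CSkip
  | CSetI of nat & iexp & iexp
  | CSetR of nat & iexp & rexp
  | CSeq of cmd & cmd
  | CIf of bexp & cmd & cmd
  | CWhile of bexp & cmd.

(* Every constant, memory access, arithmetic operation, comparison, Boolean
   connective and evaluation of [h] costs 1. *)

Fixpoint icost (e : iexp) : nat :=
  match e with
  | IConst _ => 1
  | IGet _ i => (icost i).+1
  | IAdd e1 e2 | ISub e1 e2 | IMul e1 e2 => (icost e1 + icost e2).+1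
  end.

Fixpoint rcost (e : rexp) : nat :=
  match e with
  | RConst _ => 1
  | RGet _ i => (icost i).+1
  | RAdd e1 e2 | RSub e1 e2 | RMul e1 e2 | RDiv e1 e2 =>
      (rcost e1 + rcost e2).+1
  | RH e1 => (rcost e1).+1
  end.

Fixpoint bcost (b : bexp) : nat :=
  match b with
  | BLeI e1 e2 => (icost e1 + icost e2).+1
  | BLeR e1 e2 => (rcost e1 + rcost e2).+1
  | BNot b1 => (bcost b1).+1
  | BAnd b1 b2 => (bcost b1 + bcost b2).+1
  end.

Section Semantics.
Variables (R : realType) (h : R -> R).

Record state := State {
  imem : nat -> nat -> nat;
  rmem : nat -> nat -> R }.

Definition upd T (m : nat -> nat -> T) (a i : nat) (v : T) : nat -> nat -> T :=
  fun b j => if (b == a) && (j == i) then v else m b j.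

Implicit Types s : state.

Fixpoint ieval s (e : iexp) : nat :=
  match e with
  | IConst k => k
  | IGet a i => imem s a (ieval s i)
  | IAdd e1 e2 => (ieval s e1 + ieval s e2)%N
  | ISub e1 e2 => (ieval s e1 - ieval s e2)%N
  | IMul e1 e2 => (ieval s e1 * ieval s e2)%N
  end.

Fixpoint reval s (e : rexp) : R :=
  match e with
  | RConst k => k%:R
  | RGet a i => rmem s a (ieval s i)
  | RAdd e1 e2 => reval s e1 + reval s e2
  | RSub e1 e2 => reval s e1 - reval s e2
  | RMul e1 e2 => reval s e1 * reval s e2
  | RDiv e1 e2 => reval s e1 / reval s e2
  | RH e1 => h (reval s e1)
  end.

Fixpoint beval s (b : bexp) : bool :=
  match b with
  | BLeI e1 e2 => (ieval s e1 <= ieval s e2)%N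
  | BLeR e1 e2 => reval s e1 <= reval s e2
  | BNot b1 => ~~ beval s b1
  | BAnd b1 b2 => beval s b1 && beval s b2
  end.

(* [exec c s t s']: started in [s], the program [c] halts in [s'] after time
   [t]. *)
Inductive exec : cmd -> state -> nat -> state -> Prop :=
  | ExecSkip s : exec CSkip s 1 s
  | ExecSetI s a i e :
      exec (CSetI a i e) s (icost i + icost e).+1
        (State (upd (imem s) a (ieval s i) (ieval s e)) (rmem s))
  | ExecSetR s a i e :
      exec (CSetR a i e) s (icost i + rcost e).+1
        (State (imem s) (upd (rmem s) a (ieval s i) (reval s e)))
  | ExecSeq s s1 s2 t1 t2 c1 c2 :
      exec c1 s t1 s1 -> exec c2 s1 t2 s2 ->
      exec (CSeq c1 c2) s (t1 + t2) s2
  | ExecIfTrue s s1 t b c1 c2 :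
      beval s b -> exec c1 s t s1 ->
      exec (CIf b c1 c2) s (bcost b + t).+1 s1
  | ExecIfFalse s s1 t b c1 c2 :
      ~~ beval s b -> exec c2 s t s1 ->
      exec (CIf b c1 c2) s (bcost b + t).+1 s1
  | ExecWhileDone s b c :
      ~~ beval s b -> exec (CWhile b c) s (bcost b).+1 s
  | ExecWhileStep s s1 s2 t1 t2 b c :
      beval s b -> exec c s t1 s1 -> exec (CWhile b c) s1 t2 s2 ->
      exec (CWhile b c) s (bcost b + t1 + t2).+1 s2.

Lemma exec_deterministic c s t1 s1 t2 s2 :
  exec c s t1 s1 -> exec c s t2 s2 -> t1 = t2 /\ s1 = s2.
Proof.
move=> H; elim: H t2 s2 => {c s t1 s1}.
- by move=> s t2 s2 H; inversion H; subst.
- by move=> s a i e t2 s2 H; inversion H; subst.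
- by move=> s a i e t2 s2 H; inversion H; subst.
- move=> s s1 s2 t1 t2 c1 c2 _ IH1 _ IH2 t3 s3 H; inversion H; subst.
  match goal with E : exec c1 _ _ _ |- _ => case: (IH1 _ _ E) => ? ? end; subst.
  by match goal with E : exec c2 _ _ _ |- _ => case: (IH2 _ _ E) => -> -> end.
- move=> s s1 t b c1 c2 Hb _ IH t2 s2 H; inversion H; subst.
    by match goal with E : exec c1 _ _ _ |- _ => case: (IH _ _ E) => -> -> end.
  by match goal with E : is_true (~~ _) |- _ => rewrite Hb in E end.
- move=> s s1 t b c1 c2 Hb _ IH t2 s2 H; inversion H; subst.
    by match goal with E : is_true (beval _ _) |- _ => rewrite E in Hb end.
  by match goal with E : exec c2 _ _ _ |- _ => case: (IH _ _ E) => -> -> end.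
- move=> s b c Hb t2 s2 H; inversion H; subst=> //.
  by match goal with E : is_true (beval _ _) |- _ => rewrite E in Hb end.
- move=> s s1 s2 t1 t2 b c Hb _ IH1 _ IH2 t3 s3 H; inversion H; subst.
    by match goal with E : is_true (~~ _) |- _ => rewrite Hb in E end.
  match goal with E : exec c _ _ _ |- _ => case: (IH1 _ _ E) => ? ? end; subst.
  by match goal with E : exec (CWhile _ _) _ _ _ |- _ =>
    case: (IH2 _ _ E) => -> -> end.
Qed.

(* Input: integer array 0 holds [n] at index 0, real array 0 holds the
   distances in row-major order and real array 1 the point masses; all other
   memory is zero. *)
Definition input n (d : 'I_n -> 'I_n -> R) (rho : 'I_n -> R) : state :=
  State
    (upd (fun _ _ => 0%N) 0 0 n)
    (fun a k =>
      if a == 0%N then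
        \sum_(i < n) \sum_(j < n | k == (i * n + j)%N) d i j
      else if a == 1%N then \sum_(i < n | k == i :> nat) rho i
      else 0).

(* Output: integer array 1 holds the root at index 0; for k < n - 1, the k-th
   edge has its endpoints at index k of the integer arrays 2 and 3 and its label
   at index k of the real array 2. *)
Definition output n s (C : labelled_graph R 'I_n) : Prop :=
  imem s 1 0 = tree_root C /\
  exists u v : 'I_n.-1 -> 'I_n,
    [/\ forall k : 'I_n.-1, imem s 2 k = u k /\ imem s 3 k = v k,
        edges C = [set [set u k; v k] | k : 'I_n.-1]%SET
      & forall k : 'I_n.-1, rmem s 2 k = label C [set u k; v k]%SET].

End Semantics.

(* Main.v *)
Require Import Defs.
From HB Require Import structures.
From mathcomp Require Import all_boot all_order all_algebra.
From mathcomp Require Import all_classical all_reals all_analysis.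
From mathcomp Require Import measurable_realfun lra zify.
Import Order.TTheory GRing.Theory Num.Theory.
Import numFieldNormedType.Exports.
Local Open Scope ring_scope.

(** The tree is read off nets at geometrically decreasing scales.  Let D be the
    largest distance from a root z and r_k = D 8^(1-k).  At every level k >= 2
    the points are covered greedily: the uncovered point whose ball of radius
    r_k has the largest mass becomes a centre and covers all that lies within
    2 r_k.  A point x enters the tree at the first level k at which it is a
    centre; its parent is the centre that covered it at level k - 1, and the
    label of the edge is rho(B(x, r_k)) 8^(1-k) + 1/(8n).  The balls of radius
    r_k about the centres of one level are disjoint, hence the labels sum to at
    most 1/4 + 1/8.

    Consider the root path of a point y.  A vertex x <> z of level k on it has
    rho(B(x, r_k)) >= rho(B(y, r_k / 2)) ([near_parent]): either x is so close
    to y that one ball contains the other, or x covered the previous vertex of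
    the path at level k, and then its ball is the heavier one.  The edge above x
    has length at most 2 r_(k-1) = 16 r_k, so that it costs at most
    16 r_k (h(rho(B(y, r_k / 2))) + 7 (k - 1)) ([edge_cost_le]).  Summed over
    the levels, the first terms are bounded by a lower Riemann sum of the
    integral for y ([riemann_le_gamma]), the second ones by a multiple of D; and
    D is at most 8 gamma_h, because one of two disjoint balls of radius D / 4
    has mass at most 1/2 ([dist_le_gamma]).

    Little is needed of h.  With f(0) = 1, which is what the normalization
    means, log-concavity makes the hazard rate f / F at least 1, whence
    h(p / (1 + t)) <= h(p) + t ([chaining_growth]); moreover 1 - p <= h(p)
    ([chaining_ge]).

    The number of levels is logarithmic in n however small the distances are:
    once 8^(1-k) <= 1/n, all remaining points are attached at once, by edges of
    length at most 2 D / n and label 1/(8n), and h(1/(8n)) <= 8n makes such an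
    edge cost at most 16 D.  This last level is a pass at radius 0, where every
    point is a centre.  A level takes O(n^2) steps: n masses, then n rounds in
    which a maximum is searched and a ball is covered.  The program is verified
    by triples [runs] with a time bound; the invariant of the greedy covering is
    [partial_hierarchy]. *)

Set Implicit Arguments.
Unset Strict Implicit.
Unset Printing Implicit Defensive.

(** * Tails of log-concave densities and their inverses *)

Section TailOfLogConcaveDensity.
Local Open Scope classical_set_scope.
Variables (R : realType) (f : R -> R).
Implicit Types (s t u a b : R).
Hypothesis f_density : chaining_density f.

Let f_ge0 s : 0 <= s -> 0 <= f s.
Proof. by case: f_density => + _ _ _; apply. Qed.

Let f_anti s t : 0 <= s -> s <= t -> f t <= f s.
Proof. by case: f_density => _ _ + _; apply. Qed.

Let f_cont a : 0 <= a -> {within `[a, +oo[, continuous f}.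
Proof.
move=> a0; case: f_density => _ cf _ _; apply: continuous_subspaceW cf.
by move=> x /=; rewrite !in_itv/= !andbT; exact: le_trans.
Qed.

Lemma density_measurable : measurable_fun (`[0, +oo[ : set R) f.
Proof.
apply: subspace_continuous_measurable_fun => //.
exact: f_cont.
Qed.

Let mf (A : set R) : measurable A -> A `<=` (`[0, +oo[ : set R) ->
  measurable_fun A (EFin \o f).
Proof.
move=> mA sA; apply/measurable_EFinP.
exact: measurable_funS density_measurable.
Qed.

Lemma tail0 : tail f 0 = 1%E. Proof. by case: f_density. Qed.

Lemma tail_split a b : 0 <= a -> a <= b ->
  tail f a = (\int[lebesgue_measure]_(t in `[a, b[) (f t)%:E + tail f b)%E.
Proof.
move=> a0 ab; rewrite /tail -ge0_integral_setU//=.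
- by rewrite -itv_bndbnd_setU// bnd_simp.
- apply: mf; first exact: measurableU.
  move=> x [] /=; rewrite !in_itv/= !andbT; last first.
    by apply/le_trans/(le_trans a0).
  by move=> /andP[+ _]; exact: le_trans.
- move=> x xab; rewrite lee_fin f_ge0//.
  case: xab => /=; rewrite in_itv/= ?andbT.
    by move=> /andP[+ _]; exact: le_trans.
  by apply/le_trans/(le_trans a0).
- apply/disj_setPS => x [] /=; rewrite !in_itv/= => /andP[_ xb] /andP[bx _].
  by have := lt_le_trans xb bx; rewrite ltxx.
Qed.

Lemma le_tail_split a b : 0 <= a -> a <= b ->
  (tail f b + ((b - a) * f b)%:E <= tail f a)%E.
Proof.
move=> a0 ab; rewrite (tail_split a0 ab) addeC; apply: leeD => //.
have -> : ((b - a) * f b)%:E =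
    (\int[lebesgue_measure]_(t in `[a, b[) (cst (f b)%:E) t)%E.
  rewrite integral_cst//= lebesgue_measure_itv/= lte_fin.
  case: ltP => [_|ba]; first by rewrite -EFinB -EFinM mulrC.
  have -> : a = b by apply/eqP; rewrite eq_le ab.
  by rewrite subrr mul0r mule0.
have sab : `[a, b[ `<=` (`[0, +oo[ : set R).
  by move=> x /=; rewrite !in_itv/= andbT => /andP[+ _]; exact: le_trans.
apply: ge0_le_integral => //=.
- by move=> x _; rewrite lee_fin f_ge0// (le_trans a0).
- exact: mf.
- move=> x; rewrite in_itv/= => /andP[ax xb].
  by rewrite lee_fin f_anti// ?(ltW xb)// (le_trans a0).
Qed.

Lemma ge_tail_split b : 0 <= b -> (1 <= tail f b + (b * f 0)%:E)%E.
Proof.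
move=> b0; rewrite -tail0 (tail_split (lexx 0) b0) addeC; apply: leeD => //.
have -> : (b * f 0)%:E =
    (\int[lebesgue_measure]_(t in `[0%R, b[) (cst (f 0)%:E) t)%E.
  rewrite integral_cst//= lebesgue_measure_itv/= lte_fin.
  case: ltP => [_|ba]; first by rewrite -EFinB -EFinM subr0 mulrC.
  by have -> : b = 0 by [apply/eqP; rewrite eq_le ba]; rewrite mul0r mule0.
have sab : (`[0, b[ : set R) `<=` (`[0, +oo[ : set R).
  by move=> x /=; rewrite !in_itv/= andbT => /andP[+ _].
apply: ge0_le_integral => //=.
- by move=> x; rewrite in_itv/= => /andP[x0 _]; rewrite lee_fin f_ge0.
- exact: mf.
- by move=> x; rewrite in_itv/= => /andP[x0 _]; rewrite lee_fin f_anti.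
Qed.

(** The substitution u = t - s. *)
Lemma tail_shift s : 0 <= s ->
  tail f s = (\int[lebesgue_measure]_(u in `[0%R, +oo[) (f (s + u))%:E)%E.
Proof.
move=> s0; have dF : (fun x : R => s + x)^`() = cst 1.
  by apply/funext => x; rewrite derive1E deriveD// derive_cst derive_id add0r.
rewrite /tail -[in LHS](addr0 s).
rewrite (@increasing_ge0_integration_by_substitutiony _ (fun x => s + x)).
- by apply: eq_integral => x _ /=; rewrite dF /= mulr1.
- by move=> x y _ _ xy; rewrite ltrD2l.
- by rewrite dF => x _; exact: cst_continuous.
- by rewrite dF; exact: is_cvg_cst.
- by rewrite dF; exact: is_cvg_cst.
- split.
    move=> x _; apply: derivableD;
        [exact: derivable_cst|exact: derivable_id].
  apply: cvg_at_right_filter; apply: cvgD; first exact: cvg_cst.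
  exact: cvg_id.
- exact: cvg_addrl.
- by rewrite addr0; exact: f_cont.
- move=> x; rewrite in_itv/= andbT addr0 => sx.
  by rewrite f_ge0// (le_trans s0)// ltW.
Qed.

Hypothesis f_log_concave : log_concave f.

(** Both [s] and [u] lie between 0 and [s + u], with exchanged weights. *)
Lemma log_concave_cross s u : 0 <= s -> 0 <= u ->
  f (s + u) * f 0 <= f s * f u.
Proof.
move=> s0 u0; have := addr_ge0 s0 u0.
rewrite le_eqVlt => /predU1P[/esym su|su].
  have [-> ->] : s = 0 /\ u = 0 by split; lra.
  by rewrite addr0.
pose a := s / (s + u).
have a0 : 0 <= a by rewrite divr_ge0// ltW.
have a1 : a <= 1 by rewrite ler_pdivrMr// mul1r lerDl.
have b0 : 0 <= 1 - a by rewrite subr_ge0.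
have b1 : 1 - a <= 1 by rewrite lerBlDr lerDl.
have as_ : a * (s + u) = s by rewrite /a divfK// gt_eqF.
have := f_log_concave (ltW su) (lexx 0) a0 a1.
have := f_log_concave (ltW su) (lexx 0) b0 b1.
rewrite !mulr0 !addr0 mulrBl mul1r !as_ subKr addrAC subrr add0r.
move=> fu fs; apply: le_trans (ler_pM _ _ fs fu); rewrite ?mulr_ge0 ?powR_ge0//.
rewrite mulrACA -powRD; last by rewrite subrKC oner_eq0.
rewrite (mulrC (f 0 `^ _)) mulrC.
rewrite (mulrC (f 0 `^ _)) -powRD; last by rewrite subrKC oner_eq0.
by rewrite !subrKC !powRr1 ?f_ge0// ?ltW// mulrC.
Qed.

(** The hazard rate f/F is smallest at 0, where it is [f 0]: integrate
    [log_concave_cross] over [u]. *)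
Lemma tail_hazard s : 0 <= s -> (tail f s * (f 0)%:E <= (f s)%:E)%E.
Proof.
move=> s0; have s1 : (`[0, +oo[ : set R) `<=` [set x : R | 0 <= x].
  by move=> x /=; rewrite in_itv/= andbT.
rewrite -[leRHS]mule1 -tail0 tail_shift// muleC.
have mfs : measurable_fun (`[0, +oo[ : set R) (fun u => (f (s + u))%:E).
  apply/measurable_EFinP/(measurable_comp (F := (`[0, +oo[ : set R))) => //.
  - by move=> _ /= [x + <-]; rewrite !in_itv/= !andbT; exact: addr_ge0.
  - exact: density_measurable.
  - exact: measurable_funD.
rewrite -!ge0_integralZl//=; first last.
- by rewrite lee_fin f_ge0.
- by move=> x /s1 /= x0; rewrite lee_fin f_ge0// addr_ge0.
- by rewrite lee_fin f_ge0.
- by move=> x /s1 /= x0; rewrite lee_fin f_ge0.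
- exact: mf.
apply: ge0_le_integral => //=.
- by move=> x /s1 /= x0; rewrite -EFinM lee_fin mulr_ge0// f_ge0// addr_ge0.
- exact: measurable_funeM.
- by apply: measurable_funeM; exact: mf.
- move=> x /s1 /= x0; rewrite -!EFinM lee_fin mulrC.
  exact: log_concave_cross.
Qed.

End TailOfLogConcaveDensity.

Section LogConcaveChainingFunctional.
Local Open Scope classical_set_scope.
Variables (R : realType) (h : R -> R).
Implicit Types (p q t : R).
Hypothesis h_log_concave : log_concave_chaining_functional h.
Hypothesis h_normalized : exists2 l : R, has_left_derivative h 1 l & `|l| = 1.

Lemma chaining_ge0 p : 0 < p -> p <= 1 -> 0 <= h p.
Proof. by case: h_log_concave => f [_ hf _] p0 p1; case: (hf p p0 p1). Qed.

Lemma chaining_antitone p q : 0 < p -> p <= q -> q <= 1 -> h q <= h p.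
Proof.
case: h_log_concave => f [df hf _] p0 pq q1.
have [hp0 tp] := hf p p0 (le_trans pq q1).
have [hq0 tq] := hf q (lt_le_trans p0 pq) q1.
rewrite leNgt; apply/negP => hpq.
have := le_tail_split df hp0 (ltW hpq); rewrite tp tq -EFinD lee_fin => le1.
have f0 : 0 <= f (h q) by case: df => + _ _ _; apply.
have f1 : 0 <= (h q - h p) * f (h q) by rewrite mulr_ge0// subr_ge0 ltW.
have epq : p = q by lra.
by move: hpq; rewrite epq ltxx.
Qed.

(** As p tends to 1, h p / (1 - p) tends both to 1, by the normalization, and
    to 1 / f 0, because F decreases at rate [f 0] at 0. *)
Let density_witness :
  exists f, [/\ chaining_density f, induced_by h f, log_concave f & f 0 = 1].
Proof.
case: h_log_concave => f [df hf lf]; exists f; split=> //.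
have [f_ge0 fc fa _] := df; have t0 := tail0 df.
have f00 : 0 < f 0.
  rewrite lt_neqAle f_ge0// andbT; apply/eqP => f0.
  have [h1 t1] := hf (1 / 2) ltac:(lra) ltac:(lra).
  have := ge_tail_split df h1.
  by rewrite t1 -f0 mulr0 adde0 lee_fin; lra.
have h1 : h 1 = 0.
  have [h10 t1] := hf 1 ltr01 (lexx _).
  have := tail_hazard df lf h10; rewrite t1 mul1e lee_fin => f1.
  have := le_tail_split df (lexx 0) h10.
  rewrite t0 t1 -EFinD lee_fin subr0 => H.
  have : h 1 * f (h 1) <= 0 by lra.
  rewrite pmulr_lle0 ?(lt_le_trans f00 f1)// => h1.
  by apply/eqP; rewrite eq_le h1.
have hge p : 0 < p -> p <= 1 -> 1 - p <= h p * f 0.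
  move=> p0 p1; have [hp0 tp] := hf p p0 p1.
  have := ge_tail_split df hp0.
  by rewrite tp -EFinD lee_fin; lra.
case: h_normalized => l hl l1.
have ratio : ((h p) / (1 - p)) @[p --> (1:R)^'-] --> (1:R).
  rewrite -[X in _ --> X]l1; apply: cvg_trans (cvg_norm hl).
  apply: near_eq_cvg.
  near=> p.
  have p0 : 0 < p by near: p; apply: nbhs_left_gt.
  have p1 : p < 1 by near: p; apply: nbhs_left_lt.
  rewrite h1 subr0 normrM normfV ger0_norm ?chaining_ge0 ?(ltW p1)//.
  by rewrite distrC ger0_norm// subr_ge0 ltW.
apply/eqP; rewrite eq_le; apply/andP; split.
- rewrite leNgt; apply/negP => f01.
  (* Otherwise f >= a > 1 on some [0, e], and h p / (1 - p) <= 1 / a near 1. *)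
  pose a := (1 + f 0) / 2.
  have a1 : 1 < a by rewrite /a; lra.
  have [e [e0 fe]] : exists e, 0 < e /\ a <= f e.
    have /continuous_within_itvcyP [_ fc0] := fc.
    near (0 : R)^'+ => e; exists e; split; near: e; first exact: nbhs_right_gt.
    by apply: (cvgr_ge _ fc0); rewrite /a; lra.
  have e0a : 0 < e * a by rewrite mulr_gt0//; lra.
  suff : 1 <= a^-1 by rewrite leNgt invf_lt1 ?a1//; lra.
  apply: (cvgr_to_le ratio); near=> p.
  have p0 : 0 < p by near: p; apply: nbhs_left_gt.
  have p1 : p < 1 by near: p; apply: nbhs_left_lt.
  have pe : 1 - e * a < p by near: p; apply: nbhs_left_gt; lra.
  have [hp0 tp] := hf p p0 (ltW p1).
  have he : h p <= e.
    rewrite leNgt; apply/negP => ehp.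
    have f_hp := f_ge0 _ hp0.
    have := le_tail_split df (ltW e0) (ltW ehp).
    have := le_tail_split df (lexx 0) (ltW e0).
    rewrite t0 tp subr0.
    have : 0 <= (h p - e) * f (h p) by rewrite mulr_ge0// subr_ge0 ltW.
    have : e * a <= e * f e by rewrite ler_pM2l.
    case: (tail f e) => [x| |]//=.
    by rewrite -!EFinD !lee_fin; lra.
  have := le_tail_split df (lexx 0) hp0.
  rewrite t0 tp subr0 -EFinD lee_fin => H.
  have fhp : a <= f (h p) by exact: le_trans fe (fa _ _ hp0 he).
  rewrite ler_pdivrMr ?subr_gt0// mulrC ler_pdivlMr ?(lt_trans _ a1)//.
  have : h p * a <= h p * f (h p) by rewrite ler_wpM2l.
  lra.
- suff : (f 0)^-1 <= 1 by rewrite invf_le1.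
  apply: (cvgr_to_ge ratio); near=> p.
  have p0 : 0 < p by near: p; apply: nbhs_left_gt.
  have p1 : p < 1 by near: p; apply: nbhs_left_lt.
  rewrite ler_pdivlMr ?subr_gt0// mulrC ler_pdivrMr//.
  exact: hge (ltW p1).
Unshelve. all: by end_near. Qed.

(** As the hazard rate is at least 1, F loses a factor 1 + t over any interval
    of length t.  This is the only consequence of log-concavity that bounds [h]
    from above. *)
Lemma chaining_growth p t : 0 < p -> p <= 1 -> 0 <= t ->
  h (p / (1 + t)) <= h p + t.
Proof.
case: density_witness => f [df hf lf f0] p0 p1 t0.
have t1 : 0 < 1 + t by lra.
have q0 : 0 < p / (1 + t) by rewrite divr_gt0.
have q1 : p / (1 + t) <= 1 by rewrite ler_pdivrMr//; lra.
have [hp0 tp] := hf p p0 p1.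
have [hq0 tq] := hf _ q0 q1.
have [hqp|hpq] := leP (h (p / (1 + t))) (h p); first lra.
have := tail_hazard df lf hq0; rewrite tq f0 mule1 lee_fin => qf.
have := le_tail_split df hp0 (ltW hpq); rewrite tp tq -EFinD lee_fin.
set q := p / (1 + t) in qf q0 hpq *.
have pE : p = (1 + t) * q by rewrite /q mulrC divfK// gt_eqF.
rewrite {2}pE => H.
have : (h q - h p) * q <= (h q - h p) * f (h q).
  by rewrite ler_wpM2l// subr_ge0 ltW.
move=> H2; have : (h q - h p) * q <= t * q by lra.
by rewrite ler_pM2r//; lra.
Qed.

Lemma chaining1 : h 1 = 0.
Proof.
case: density_witness => f [df hf lf f0].
have [h10 t1] := hf 1 ltr01 (lexx _).
have := tail_hazard df lf h10; rewrite t1 f0 mule1 lee_fin => f1.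
have t0 := tail0 df.
have := le_tail_split df (lexx 0) h10; rewrite t0 t1 -EFinD lee_fin subr0 => H.
have : h 1 * 1 <= h 1 * f (h 1) by rewrite ler_wpM2l.
lra.
Qed.

Lemma chaining_ge p : 0 < p -> p <= 1 -> 1 - p <= h p.
Proof.
case: density_witness => f [df hf lf f0] p0 p1.
have [hp0 tp] := hf p p0 p1.
by have := ge_tail_split df hp0; rewrite tp f0 -EFinD lee_fin; lra.
Qed.

(** [lim] at 0 exists because [h] is monotone; it then dominates all values. *)
Lemma le_ext0 p q : 0 < q -> 0 <= p -> p <= q -> q <= 1 ->
  ((h q)%:E <= ext0 h p)%E.
Proof.
rewrite /ext0 le_eqVlt => q0 /predU1P[<- _|p0 pq] q1; last first.
  by rewrite gt_eqF// lee_fin chaining_antitone.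
rewrite eqxx.
apply: lime_ge.
  apply: (@nonincreasing_at_right_is_cvge _ (EFin \o h) 0).
  near=> b; move=> x y; rewrite !in_itv/= => /andP[x0 xb] /andP[y0 yb] xy.
  rewrite lee_fin chaining_antitone// (le_trans (ltW yb))//.
  by near: b; apply: nbhs_right_le.
near=> x.
have x0 : 0 < x by near: x; apply: nbhs_right_gt.
have xq : x <= q by near: x; apply: nbhs_right_le.
by rewrite lee_fin chaining_antitone.
Unshelve. all: by end_near. Qed.

End LogConcaveChainingFunctional.

(** * Trees given by a parent function *)

Section ParentTree.
Variables (R : realType) (X : finType) (z : X).
Variables (lev : X -> nat) (par : X -> X) (lab : X -> R).
Hypothesis par_lev : forall x, x != z -> (lev (par x) < lev x)%N.

Definition parent_edge x : {set X} := [set x; par x]%SET.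

(** Distinct vertices have distinct parent edges, so the sum that defines the
    label of an edge has a single term. *)
Definition parent_tree : labelled_graph R X :=
  LabelledGraph z [set parent_edge x | x in predC1 z]%SET
    (fun e => \sum_(x | (x != z) && (e == parent_edge x)) lab x).

Let par_neq x : x != z -> par x != x.
Proof. by move=> /par_lev; apply: contraTneq => ->; rewrite ltnn. Qed.

Lemma set2_eq (a b u v : X) : [set a; b]%SET = [set u; v]%SET ->
  (a = u /\ b = v) \/ (a = v /\ b = u).
Proof.
move=> E; have h1 := finset.set21 a b; have h2 := finset.set22 a b.
have h3 := finset.set21 u v; have h4 := finset.set22 u v.
rewrite E in h1 h2; rewrite -E in h3 h4.
move: h1 h2 h3 h4.
move=> /finset.set2P[] ? /finset.set2P[] ? /finset.set2P[] ? /finset.set2P[] ?.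
all: intuition congruence.
Qed.

Lemma parent_edge_inj x y : x != z -> y != z ->
  parent_edge x = parent_edge y -> x = y.
Proof.
move=> xz yz /set2_eq[[->]//|[xy yx]].
have := par_lev xz; have := par_lev yz; rewrite -xy yx => h1 h2.
by have := ltn_trans h1 h2; rewrite ltnn.
Qed.

Lemma label_parent_edge x : x != z -> label parent_tree (parent_edge x) = lab x.
Proof.
move=> xz; rewrite /= (bigD1 x) ?xz ?eqxx//= big1 ?addr0// => y.
case/andP => /andP[yz /eqP e] /eqP yx; case: yx.
by rewrite (parent_edge_inj xz yz e).
Qed.

Lemma adj_parent_tree u v : adj parent_tree u v ->
  (u != z /\ v = par u) \/ (v != z /\ u = par v).
Proof.
move=> /imsetP[x]; rewrite inE => xz /set2_eq[] [-> ->]; first by left.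
by right.
Qed.

Lemma adj_parent x : x != z -> adj parent_tree x (par x).
Proof. by move=> xz; apply/imsetP; exists x; rewrite ?inE. Qed.

Lemma parent_tree_adjC : symmetric (adj parent_tree).
Proof. by move=> u v; rewrite /adj /= finset.setUC. Qed.

Let connect_root x : connect (adj parent_tree) x z.
Proof.
have [k] := ubnP (lev x); elim: k x => // k IH x; rewrite ltnS => xk.
have [->|xz] := eqVneq x z; first exact: connect0.
apply: connect_trans (connect1 (adj_parent xz)) _.
exact/IH/(leq_trans (par_lev xz)).
Qed.

(** On a cycle, a vertex of maximal level has its parent on both sides. *)
Lemma parent_tree_acyclic (c : seq X) :
  ucycle (adj parent_tree) c -> (size c < 3)%N.
Proof.
case: c => // x0 c0; set c := x0 :: c0 => /andP[cc cu].
have [x xc xmax] : exists2 x, x \in c & forall y, y \in c -> (lev y <= lev x)%N.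
  case: (@arg_maxnP _ x0 (mem c) lev); first exact: mem_head.
  by move=> x xc xm; exists x.
have [i s cE] := rot_to xc.
have : cycle (adj parent_tree) (x :: s) by rewrite -cE rot_cycle.
have : uniq (x :: s) by rewrite -cE rot_uniq.
have smax y : y \in x :: s -> (lev y <= lev x)%N.
  by rewrite -cE mem_rot; exact: xmax.
have <- : size (x :: s) = size c by rewrite -cE size_rot.
case/lastP: s {cE} smax => [//|[//|y s] w] smax.
have up v : v \in x :: rcons (y :: s) w -> adj parent_tree x v -> v = par x.
  move=> /smax vx /adj_parent_tree[[_ //]|[vz xv]].
  by have := par_lev vz; rewrite -xv ltnNge vx.
move=> /= /andP[_ /andP[yw _]]; rewrite rcons_path last_rcons.
case/andP=> xy /andP[_ wx].
have yE : y = par x by apply: up xy; rewrite !inE eqxx orbT.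
have wE : w = par x.
  by apply: up; rewrite 1?parent_tree_adjC// !inE mem_rcons inE eqxx !orbT.
by move: yw; rewrite yE wE mem_rcons inE eqxx.
Qed.

Lemma parent_tree_spanning : is_spanning_tree parent_tree.
Proof.
split; last exact: parent_tree_acyclic.
- move=> e /imsetP[x]; rewrite inE => xz ->.
  by rewrite cards2 eq_sym par_neq.
- move=> u v; apply: connect_trans (connect_root u) _.
  by rewrite (sym_connect_sym parent_tree_adjC).
Qed.

Lemma sum_parent_tree (F : R -> R) :
  \sum_(e in edges parent_tree) F (label parent_tree e) =
  \sum_(x | x != z) F (lab x).
Proof.
rewrite /= big_imset /=; last first.
  by move=> x y; rewrite !inE => xz yz; exact: parent_edge_inj.
apply: eq_big => [x|x xz]; first by rewrite inE.
by rewrite -(label_parent_edge xz).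
Qed.

(** A simple path that once moves away from the root keeps moving away. *)
Lemma descending_path x y s : y != z -> x = par y ->
  path (adj parent_tree) y s -> uniq [:: x, y & s] -> last y s != z.
Proof.
elim: s x y => [|w s IH] x y yz xy //= /andP[yw ws].
rewrite -/(uniq [:: y, w & s]) => /andP[xyws us].
have [[_ wE]|[wz yE]] := adj_parent_tree yw.
  by move: xyws; rewrite xy wE !inE eqxx orbT.
exact: (IH y).
Qed.

Variables (h : R -> R) (d : X -> X -> R) (I : X -> Prop) (pot : X -> R).
Hypothesis I_par : forall x, x != z -> I x -> I (par x).
Hypothesis pot_ge0 : forall x, 0 <= pot x.
Hypothesis pot_par : forall x, x != z -> I x ->
  d x (par x) * h (lab x) + pot (par x) <= pot x.

(** A potential that pays for every edge towards the root bounds the length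
    of root paths. *)
Lemma path_length_le x : I x -> path_length h d parent_tree x <= pot x.
Proof.
move=> Ix; rewrite /path_length /root_path.
case: xgetP => [s _|_]; last by rewrite big_nil.
elim: s x Ix => [|y s IH] x Ix [/=]; first by rewrite big_nil.
case/andP=> xy ys ls us.
have [[xz yE]|[yz xE]] := adj_parent_tree xy; last first.
  by have := descending_path yz xE ys us; rewrite ls eqxx.
rewrite big_cons /=; apply: le_trans (pot_par xz Ix).
rewrite {1}yE /edge_length -/(parent_edge x) label_parent_edge// lerD2l -yE.
apply: IH; first by rewrite yE; exact: I_par.
by split=> //; move: us => /andP[].
Qed.

End ParentTree.

(** * Masses of balls and lower bounds for the value of a measure *)

Section Mass.
Variables (R : realType) (X : finType) (d : X -> X -> R) (rho : X -> R).
Hypotheses (d_metric : is_metric d) (rho_prob : is_probability rho).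
Implicit Types (A B : {set X}) (x y : X) (r : R).

Lemma mass_ge0 A : 0 <= mass rho A.
Proof. by apply: sumr_ge0 => x _; case: rho_prob. Qed.

Lemma mass_le1 A : mass rho A <= 1.
Proof.
case: rho_prob => r0 <-; rewrite [leRHS](bigID (mem A))/= lerDl.
by apply: sumr_ge0.
Qed.

Lemma le_mass A B : A \subset B -> mass rho A <= mass rho B.
Proof.
move=> AB; rewrite /mass [leRHS](big_setID A) (finset.setIidPr AB) lerDl.
by apply: sumr_ge0 => x _; case: rho_prob.
Qed.

Lemma le_mass_cball x y r s : d x y + r <= s ->
  mass rho (cball d y r) <= mass rho (cball d x s).
Proof.
case: d_metric => _ _ _ dt rs.
apply/le_mass/fintype.subsetP => u; rewrite !inE => yu.
by apply: le_trans (dt _ y _) _; apply: le_trans rs; rewrite lerD2l.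
Qed.

(** By the triangle inequality, no point lies in two of the balls. *)
Lemma sum_mass_cball_le1 (P : pred X) r :
  (forall x y, P x -> P y -> x != y -> 2 * r < d x y) ->
  \sum_(x | P x) mass rho (cball d x r) <= 1.
Proof.
move=> sep; case: rho_prob => r0 <-.
have E x : mass rho (cball d x r) = \sum_y (if d x y <= r then rho y else 0).
  by rewrite /mass -big_mkcond; apply: eq_bigl => y; rewrite inE.
under eq_bigr do rewrite E.
rewrite exchange_big; apply: ler_sum => y _.
have [x0 /andP[Px0 x0y]|none] := pickP (fun x => P x && (d x y <= r));
  last first.
  by rewrite big1 => // x Px; have := none x; rewrite Px /= => ->.
rewrite (bigD1 x0)//= x0y big1 ?addr0// => x /andP[Px xx0].
case: ifP => // xy; have := sep _ _ Px Px0 xx0.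
case: d_metric => _ _ ds dt; have := dt x y x0; rewrite (ds y x0); lra.
Qed.

End Mass.

Section GammaLowerBound.
Local Open Scope classical_set_scope.
Variables (R : realType) (X : finType) (d : X -> X -> R) (rho : X -> R).
Hypotheses (d_metric : is_metric d) (rho_prob : is_probability rho).
Variable h : R -> R.
Hypothesis h_lc : log_concave_chaining_functional h.

Let ball_mass x r := mass rho (cball d x r).
Let g x (r : R) := ext0 h (ball_mass x r).

Lemma ext0_antitone (p q : R) : 0 <= p -> p <= q -> q <= 1 ->
  (ext0 h q <= ext0 h p)%E.
Proof.
move=> p0 pq q1; have := le_trans p0 pq; rewrite le_eqVlt => /predU1P[q0|q0].
  by have -> : p = q by [apply/eqP; rewrite eq_le pq -q0 p0].
rewrite {1}/ext0 gt_eqF//; exact: le_ext0.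
Qed.

Lemma ext0_ge0 (p : R) : 0 <= p -> p <= 1 -> (0 <= ext0 h p)%E.
Proof.
move=> p0 p1; apply: (@le_trans _ _ (h 1)%:E).
  by rewrite lee_fin chaining_ge0.
exact: le_ext0.
Qed.

Let g_antitone x r s : r <= s -> (g x s <= g x r)%E.
Proof.
move=> rs; apply: ext0_antitone;
  rewrite ?(mass_ge0 rho_prob) ?(mass_le1 rho_prob)//.
apply: (le_mass_cball d_metric rho_prob).
by case: d_metric => _ /(_ x x)[_ ->]// _ _; rewrite add0r.
Qed.

Let g_ge0 x r : (0 <= g x r)%E.
Proof.
by apply: ext0_ge0; rewrite ?(mass_ge0 rho_prob) ?(mass_le1 rho_prob).
Qed.

Let g_measurable x (A : set R) : measurable A -> measurable_fun A (g x).
Proof.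
move=> mA; apply: measurable_funS (measurableT) _ _ => //.
apply: (measurability (@ErealGenCInfty.G R)) => [|/= _ [_] [r] -> <-].
  exact: ErealGenCInfty.measurableE.
rewrite setTI; apply: is_interval_measurable => s t/=.
rewrite !in_itv/= !andbT => fs ft u /andP[su ut].
rewrite in_itv/= andbT; apply: (le_trans ft); exact: g_antitone.
Qed.

(** On each interval from [a k.+1] to [a k] the integrand is at least its value
    at [a k].  The real function [phi] stands for a truncation of the integrand,
    which may be infinite. *)
Lemma riemann_le_integral x (a : nat -> R) (phi : R -> R) (i j : nat) :
  (i <= j)%N -> 0 <= a j ->
  (forall k, (i <= k < j)%N -> a k.+1 <= a k) ->
  (forall r, 0 <= r -> 0 <= phi r /\ ((phi r)%:E <= g x r)%E) ->
  ((\sum_(i <= k < j) (a k - a k.+1) * phi (a k))%:E <=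
    \int[lebesgue_measure]_(r in `[a j, a i[) g x r)%E.
Proof.
move=> ij + + phig; elim: j ij => [|j IH].
  by rewrite leqn0 => /eqP-> *; rewrite big_geq// integral_ge0.
rewrite leq_eqVlt => /predU1P[->|].
  by move=> *; rewrite big_geq// integral_ge0.
rewrite ltnS => ij aj adec.
have aj1 : a j.+1 <= a j by apply: adec; rewrite ij/=.
have aji : a j <= a i.
  have {}adec k : (i <= k)%N -> (k < j)%N -> a k.+1 <= a k.
    by move=> ik kj; apply: adec; rewrite ik ltnW.
  elim: j ij adec {IH aj aj1} => [|j IH]; first by rewrite leqn0 => /eqP ->.
  rewrite leq_eqVlt => /predU1P[-> //|]; rewrite ltnS => ij adec.
  apply: le_trans (adec j ij _) (IH ij _) => // k ik kj.
  by apply: adec; rewrite // ltnW// ltnS.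
rewrite big_nat_recr//= EFinD.
have -> : `[a j.+1, a i[ = `[a j.+1, a j[ `|` `[a j, a i[.
  by rewrite -itv_bndbnd_setU// bnd_simp.
rewrite ge0_integral_setU//=; first last.
- apply/disj_setPS => y [] /=; rewrite !in_itv/= => /andP[_ xb] /andP[bx _].
  by have := lt_le_trans xb bx; rewrite ltxx.
- apply: g_measurable; exact: measurableU.
rewrite addeC; apply: leeD.
  have [p0 pg] := phig _ (le_trans aj aj1).
  have -> : ((a j - a j.+1) * phi (a j))%:E =
    (\int[lebesgue_measure]_(t in `[a j.+1, a j[) (cst (phi (a j))%:E) t)%E.
    rewrite integral_cst//= lebesgue_measure_itv/= lte_fin.
    case: ltP => [_|ba]; first by rewrite -EFinB -EFinM mulrC.
    have -> : a j.+1 = a j by [apply/eqP; rewrite eq_le aj1].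
    by rewrite subrr mul0r mule0.
  apply: ge0_le_integral => //=; first exact: g_measurable.
  move=> y; rewrite in_itv/= => /andP[_ /ltW yj].
  by apply: le_trans pg _; exact: g_antitone.
apply: IH => //; first exact: le_trans aj1.
by move=> k /andP[ik kj]; apply: adec; rewrite ik ltnW.
Qed.

Lemma riemann_le_gamma x (a : nat -> R) (phi : R -> R) (i j : nat) :
  (i <= j)%N -> 0 <= a j ->
  (forall k, (i <= k < j)%N -> a k.+1 <= a k) ->
  (forall r, 0 <= r -> 0 <= phi r /\ ((phi r)%:E <= g x r)%E) ->
  ((\sum_(i <= k < j) (a k - a k.+1) * phi (a k))%:E <= gamma_h h d rho)%E.
Proof.
move=> ij aj adec phig; apply: le_trans (riemann_le_integral ij aj adec phig) _.
apply: (@le_trans _ _ (\int[lebesgue_measure]_(r in `[0%R, +oo[) g x r)%E).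
  apply: ge0_subset_integral => //; first exact: g_measurable.
  by move=> y /=; rewrite !in_itv/= andbT => /andP[+ _]; exact: le_trans.
by apply: ereal_sup_ubound; exists x.
Qed.

Hypothesis h_normalized : exists2 l : R, has_left_derivative h 1 l & `|l| = 1.

(** Two balls of radius less than half the distance of their centres are
    disjoint, so that one of them has mass at most 1/2. *)
Lemma dist_le_gamma x y : ((d x y / 8)%:E <= gamma_h h d rho)%E.
Proof.
have [dp d0 ds dt] := d_metric.
have := dp x y; rewrite le_eqVlt => /predU1P[<-|].
  have := @riemann_le_gamma x (cst 0) (cst 0) 0 0.
  by rewrite big_geq// mul0r; apply.
wlog : x y / ball_mass x (d x y / 4) <= 2^-1.
  move=> H dxy.
  have [|hx] := leP (ball_mass x (d x y / 4)) 2^-1; first by move/H; apply.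
  have [|hy] := leP (ball_mass y (d x y / 4)) 2^-1.
    by rewrite ds => /H; apply; rewrite ds.
  have xy : x != y by apply: contraTneq dxy => ->; rewrite (d0 y y).2// ltxx.
  have := @sum_mass_cball_le1 _ _ d rho d_metric rho_prob
    (pred2 x y) (d x y / 4).
  rewrite (bigD1 x) ?inE ?eqxx//= (bigD1 y) ?inE ?eqxx ?orbT ?(eq_sym y) ?xy//=.
  rewrite big1 ?addr0; last by move=> w /andP[/andP[/orP[->|->]]].
  have sep : 2 * (d x y / 4) < d x y by lra.
  move=> K.
  suff : ball_mass x (d x y / 4) + ball_mass y (d x y / 4) <= 1.
    by move=> le1; exfalso; move: hx hy le1; lra.
  apply: K => u v /= /orP[]/eqP-> /orP[]/eqP->; rewrite ?eqxx// => _.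
  by rewrite (ds y x).
move=> half dxy.
pose a k := if k == 0%N then d x y / 4 else 0.
have dxy0 := dp x y.
have := @riemann_le_gamma x a (fun r => if r <= d x y / 4 then 2^-1 else 0) 0 1.
rewrite big_nat1 /a /= lexx subr0 => H.
have -> : d x y / 8 = d x y / 4 * 2^-1 by move: (d x y) => D; lra.
apply: H => //.
- by move=> k; rewrite ltnS leqn0 => /eqP-> /=; rewrite divr_ge0.
- move=> r r0; case: ifP => rd; last by split=> //; exact: g_ge0.
  split; first by lra.
  apply: le_trans (ext0_antitone _ _ _ : (ext0 h 2^-1 <= _)%E).
  + rewrite /ext0 gt_eqF ?invr_gt0// lee_fin.
    have := chaining_ge h_lc h_normalized (_ : 0 < 2^-1 :> R).
    by lra.
  + exact: (mass_ge0 rho_prob).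
  + apply: le_trans half; apply: (le_mass_cball d_metric rho_prob).
    by rewrite (d0 x x).2// add0r.
  + by lra.
Qed.

End GammaLowerBound.

(** * Hierarchies of nets and the value of their trees *)

Section Scales.
Variables (R : realType) (L : nat).

(** The level [L] has scale 0: its balls are points and its net is the whole
    space, so that it needs no separate treatment. *)
Definition scale (k : nat) : R := if (k < L)%N then 8^-1 ^+ k.-1 else 0.

Lemma scale_ge0 k : 0 <= scale k.
Proof. by rewrite /scale; case: ifP => // _; rewrite exprn_ge0// invr_ge0. Qed.

Lemma scale_ltL k : (k < L)%N -> scale k = 8^-1 ^+ k.-1.
Proof. by rewrite /scale => ->. Qed.

Lemma scale_gt0 k : (k < L)%N -> 0 < scale k.
Proof. by move=> kL; rewrite scale_ltL// exprn_gt0// invr_gt0. Qed.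

Lemma scaleL : scale L = 0. Proof. by rewrite /scale ltnn. Qed.

Lemma scaleS k : (0 < k)%N -> (k.+1 < L)%N -> scale k.+1 = scale k / 8.
Proof.
case: k => // k _ kL; rewrite /scale kL ltnW//=.
by rewrite exprSr.
Qed.

Lemma scaleS_le k : (0 < k)%N -> scale k.+1 <= scale k / 8.
Proof.
move=> k0; have [/scaleS->//|Lk] := ltnP k.+1 L.
by rewrite {1}/scale ltnNge Lk/= divr_ge0// scale_ge0.
Qed.

Lemma scale_antitone i j : (0 < i)%N -> (i <= j)%N -> scale j <= scale i.
Proof.
move=> i0; elim: j => [|j IH]; first by rewrite leqn0 => /eqP ->.
rewrite leq_eqVlt => /predU1P[->//|]; rewrite ltnS => ij.
apply: le_trans (IH ij); apply: le_trans (scaleS_le (leq_trans i0 ij)) _.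
by rewrite ler_pdivrMr// ler_peMr ?scale_ge0//; lra.
Qed.

Lemma scale1_le k : (0 < k)%N -> scale k <= 1.
Proof.
rewrite /scale; case: ifP => // _ _.
by rewrite exprn_ile1// ?invr_ge0// invf_le1//; lra.
Qed.

Lemma sum_scale m : \sum_(2 <= k < m) scale k <= 4^-1.
Proof.
have H j : \sum_(2 <= k < j.+2) scale k <= (1 - 8^-1 ^+ j) / 7.
  elim: j => [|j IH]; first by rewrite big_geq// expr0 subrr mul0r.
  rewrite big_nat_recr//= exprSr.
  have x0 : 0 <= 8^-1 ^+ j :> R by rewrite exprn_ge0// invr_ge0.
  have : scale j.+2 <= 8^-1 ^+ j / 8.
    by rewrite /scale; case: ifP => _; rewrite /= ?exprSr// divr_ge0.
  by move: x0 IH; set x := 8^-1 ^+ j; lra.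
case: m => [|[|m]]; [by rewrite big_geq ?invr_ge0.. |].
have x0 : 0 <= 8^-1 ^+ m :> R by rewrite exprn_ge0// invr_ge0.
by have := H m; move: x0; set x := 8^-1 ^+ m; lra.
Qed.

Lemma sum_scale_level m : \sum_(2 <= k < m) scale k * k.-1%:R <= 1.
Proof.
have H j : \sum_(2 <= k < j.+2) scale k * k.-1%:R <= 1 - j.+1%:R * 8^-1 ^+ j.
  elim: j => [|j IH]; first by rewrite big_geq// expr0 mul1r subrr.
  rewrite big_nat_recr//= exprSr.
  have x0 : 0 <= 8^-1 ^+ j :> R by rewrite exprn_ge0// invr_ge0.
  have y0 : 0 <= j.+1%:R * 8^-1 ^+ j :> R by rewrite mulr_ge0.
  have : scale j.+2 * j.+1%:R <= (j.+1%:R * 8^-1 ^+ j) / 8.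
    rewrite /scale; case: ifP => _; rewrite /= ?mul0r ?divr_ge0//.
    by rewrite exprSr mulrC mulrA.
  have -> : j.+2%:R * (8^-1 ^+ j / 8) =
      (j.+1%:R * 8^-1 ^+ j) / 8 + 8^-1 ^+ j / 8 :> R.
    by rewrite -(addn1 j.+1) natrD mulrDl mul1r mulrA.
  have : 8^-1 ^+ j <= j.+1%:R * 8^-1 ^+ j :> R.
    by rewrite ler_peMl// ler1n.
  move: x0 y0 IH; set y := j.+1%:R * _; set x := 8^-1 ^+ j; lra.
case: m => [|[|m]]; [by rewrite big_geq.. |].
by apply: le_trans (H m) _; rewrite lerBlDr lerDl mulr_ge0.
Qed.

End Scales.

Section Hierarchy.
Variables (R : realType) (X : finType) (d : X -> X -> R) (rho : X -> R).
Variables (D : R) (L : nat) (z : X).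

Local Notation radius k := (D * scale R L k).
Local Notation ball_mass x r := (mass rho (cball d x r)).

(** What the greedy choice of centres provides for a point [x] that enters at
    level [k] and the centre [p] that covers it at level [k.-1]; the comparison
    of masses is lost when [p] has entered earlier, at a larger radius. *)
Definition link (lev : X -> nat) (k : nat) (x p : X) : Prop :=
  [/\ (0 < lev p < k)%N, d x p <= 2 * radius k.-1
    & lev p = k.-1 ->
      ball_mass x (radius k.-1) <= ball_mass p (radius k.-1)].

(** The second summand keeps the label of a massless ball positive, and is the
    whole label at scale 0. *)
Definition tree_label (lev : X -> nat) (x : X) : R :=
  ball_mass x (radius (lev x)) * scale R L (lev x) + 1 / (8 * #|X|%:R).

Record hierarchy (lev : X -> nat) (par : X -> X) : Prop := Hierarchy {
  level_root : lev z = 1%N;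
  level_bounds : forall x, x != z -> (1 < lev x <= L)%N;
  parent_link : forall x, x != z -> link lev (lev x) x (par x);
  level_separated : forall x y, x != y -> (1 < lev x)%N -> lev x = lev y ->
    2 * radius (lev x) < d x y }.

Hypotheses (d_metric : is_metric d) (rho_prob : is_probability rho).
Variable h : R -> R.
Hypothesis h_lc : log_concave_chaining_functional h.
Hypothesis h_normalized : exists2 l : R, has_left_derivative h 1 l & `|l| = 1.
Hypothesis D_ge0 : 0 <= D.
Hypothesis L_ge2 : (2 <= L)%N.
Hypothesis last_scale : scale R L L.-1 * #|X|%:R <= 1.
Variables (lev : X -> nat) (par : X -> X).
Hypothesis hier : hierarchy lev par.

Let eps : R := 1 / (8 * #|X|%:R).

Let X_gt0 : 1 <= #|X|%:R :> R.
Proof. by rewrite ler1n; apply/card_gt0P; exists z. Qed.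

Let eps_gt0 : 0 < eps.
Proof. by rewrite /eps divr_gt0// mulr_gt0//; move: X_gt0; lra. Qed.

Let eps_le : eps <= 8^-1.
Proof.
rewrite /eps mul1r invfM ler_piMr ?invr_ge0// invf_le1//.
by move: X_gt0; lra.
Qed.

Let par_lev x : x != z -> (lev (par x) < lev x)%N.
Proof. by move=> xz; have [/andP[]] := parent_link hier xz. Qed.

Lemma tree_label_bounds x : x != z -> 0 < tree_label lev x < 2^-1.
Proof.
move=> xz; have /andP[k1 kL] := level_bounds hier xz.
have m0 := mass_ge0 rho_prob (cball d x (radius (lev x))).
have m1 := mass_le1 rho_prob (cball d x (radius (lev x))).
have s0 := scale_ge0 R L (lev x).
have s1 : scale R L (lev x) <= 8^-1.
  have -> : 8^-1 = 1 / 8 :> R by rewrite mul1r.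
  case: (lev x) k1 => // k k1; apply: le_trans (scaleS_le _ _ k1) _.
  by rewrite ler_pM2r ?invr_gt0// scale1_le.
have : ball_mass x (radius (lev x)) * scale R L (lev x) <= 1 * 8^-1.
  by rewrite ler_pM.
have : 0 <= ball_mass x (radius (lev x)) * scale R L (lev x).
  by rewrite mulr_ge0.
rewrite /tree_label -/eps; move: eps_gt0 eps_le; lra.
Qed.

(** Balls of centres of one level are disjoint, so that a level contributes at
    most its scale to the first summands. *)
Lemma sum_tree_label : \sum_(x | x != z) tree_label lev x <= 2^-1.
Proof.
rewrite big_split/= -/eps.
have -> : 2^-1 = 4^-1 + 4^-1 :> R by lra.
apply: lerD; last first.
  apply: (@le_trans _ _ (\sum_(x : X) eps)).
    rewrite [leRHS](bigID (fun x => x != z))/= lerDl sumr_ge0// => *.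
    exact: ltW.
  have n0 : #|X|%:R != 0 :> R by rewrite gt_eqF//; move: X_gt0; lra.
  rewrite sumr_const -[leLHS]mulr_natr; set m := #|_|.
  have -> : m = #|X| by apply: eq_card.
  by rewrite /eps mul1r invfM divfK//; lra.
apply: le_trans (sum_scale R L L.+1).
have bnd x : x != z -> (lev x < L.+1)%N.
  by move=> /(level_bounds hier)/andP[].
rewrite big_geq_mkord (partition_big (fun x => inord (lev x) : 'I_L.+1)
  (fun j : 'I_L.+1 => (1 < j)%N))/=; last first.
  by move=> x xz; rewrite inordK ?bnd//; have /andP[] := level_bounds hier xz.
apply: ler_sum => j j1.
have jE x : (x != z) && (inord (lev x) == j) -> lev x = j.
  by case/andP=> xz /eqP <-; rewrite inordK ?bnd.
under eq_bigr => x /jE xj do rewrite xj.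
rewrite -mulr_suml ler_piMl ?scale_ge0//.
apply: (sum_mass_cball_le1 d_metric rho_prob) => x y /jE xj /jE yj xy.
by rewrite -xj; apply: (level_separated hier); rewrite ?xj.
Qed.

(** Dividing the argument by 8 = 1 + 7 adds at most 7 to the functional. *)
Lemma chaining_scale_growth (p : R) k : 0 < p -> p <= 1 -> (k < L)%N ->
  h (scale R L k * p) <= h p + 7 * k.-1%:R.
Proof.
move=> p0 p1 kL; rewrite scale_ltL//; elim: k.-1 => [|j IH].
  by rewrite expr0 mul1r mulr0 addr0.
have q0 : 0 < 8^-1 ^+ j * p by rewrite mulr_gt0// exprn_gt0// invr_gt0.
have q1 : 8^-1 ^+ j * p <= 1.
  rewrite mulr_ile1 ?exprn_ge0 ?invr_ge0 ?(ltW p0)//.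
  by rewrite exprn_ile1 ?invr_ge0 ?invf_le1//; lra.
have := chaining_growth h_lc h_normalized q0 q1 (ler0n R 7).
have -> : 8^-1 ^+ j * p / (1 + 7) = 8^-1 ^+ j.+1 * p.
  by rewrite exprSr -!mulrA (mulrC p); congr (_ * (_^-1 * _)); lra.
move: IH; rewrite -(natr1 j); lra.
Qed.

Section FromOnePoint.
Variable y : X.

(** Truncation at the smallest label keeps [h (q k)] finite where the ball has
    no mass. *)
Let q k := Num.max (ball_mass y (radius k / 2)) eps.

(** The invariant along the root path of [y].  The bound on the distance is what
    the step to the next vertex needs; the bound on the mass is what the cost of
    the edge above [x] needs. *)
Definition near_point x : Prop := x = z \/
  d y x <= 2 / 7 * radius (lev x).-1 /\
  ball_mass y (radius (lev x) / 2) <= ball_mass x (radius (lev x)).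

Let dxx x : d x x = 0. Proof. by case: d_metric => _ /(_ x x)[_ ->]. Qed.

Let radius_ge0 k : 0 <= radius k. Proof. by rewrite mulr_ge0// scale_ge0. Qed.

Lemma near_self : near_point y.
Proof.
right; split; first by rewrite dxx mulr_ge0 ?radius_ge0//; lra.
apply: (le_mass_cball d_metric rho_prob); rewrite dxx add0r.
by have := radius_ge0 (lev y); lra.
Qed.

(** Let [x] have level k' and its parent level k.  If k = k'.-1, the parent has
    the heavier ball of radius [radius k], and that of [x] contains the ball of
    half the radius about [y].  If k < k'.-1, the parent itself is close to [y]
    in comparison with [radius k]. *)
Lemma near_parent x : x != z -> near_point x -> near_point (par x).
Proof.
move=> xz [xz'|[dyx mx]]; first by rewrite xz' eqxx in xz.
have [pz|pz] := eqVneq (par x) z; [by left | right].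
have [/andP[_ kk'] dxp mxp] := parent_link hier xz.
have /andP[_ k'L] := level_bounds hier xz.
have /andP[k1 _] := level_bounds hier pz.
move: (lev (par x)) (lev x) k1 kk' k'L dyx mx dxp mxp.
move=> k k' k1 kk' k'L dyx mx dxp mxp.
have [_ _ ds dt] := d_metric.
have dyp : d y (par x) <= 16 / 7 * radius k'.-1 by have := dt y x (par x); lra.
have k0 : (0 < k)%N by exact: ltnW.
have kk : (k <= k'.-1)%N by case: k' kk' {mx dyx dxp mxp k'L dyp}.
have rk : radius k'.-1 <= radius k.
  by rewrite ler_wpM2l// scale_antitone.
have rk1 : radius k = radius k.-1 / 8.
  case: k k1 k0 kk kk' {mxp rk} => // k k1 k0 kk kk'; rewrite scaleS ?mulrA//.
  exact: leq_trans kk' k'L.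
split; first by have := radius_ge0 k; lra.
have r0 := radius_ge0 k.
move: kk; rewrite leq_eqVlt => /predU1P[ke|kk].
  have {}mxp := mxp ke; rewrite -ke in mxp dyx dxp.
  apply: le_trans mxp; apply: (le_mass_cball d_metric rho_prob).
  by rewrite ds; lra.
have rk' : radius k'.-1 <= radius k / 8.
  rewrite -mulrA ler_wpM2l//; apply: le_trans (scaleS_le _ _ k0).
  exact: scale_antitone.
by apply: (le_mass_cball d_metric rho_prob); rewrite ds; lra.
Qed.

(** Edges of level [L] have length at most 2 D / n and label 1 / (8 n), at which
    [h] is at most 8 n. *)
Definition level_cost k : R :=
  if (k < L)%N then 16 * radius k * (h (q k) + 7 * k.-1%:R) else 16 * D.

Let q_bounds k : 0 < q k <= 1.
Proof.
rewrite /q lt_max eps_gt0 orbT/= ge_max (mass_le1 rho_prob)/=.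
by move: eps_le; lra.
Qed.

Let hq_ge0 k : 0 <= h (q k).
Proof. by have /andP[q0 q1] := q_bounds k; exact: chaining_ge0. Qed.

Lemma level_cost_ge0 k : 0 <= level_cost k.
Proof.
rewrite /level_cost; case: ifP => _; last by rewrite mulr_ge0.
by apply: mulr_ge0; [exact: mulr_ge0 | apply: addr_ge0; rewrite ?mulr_ge0].
Qed.

Lemma edge_cost_le x : x != z -> near_point x ->
  d x (par x) * h (tree_label lev x) <= level_cost (lev x).
Proof.
move=> xz [xz'|[_ mx]]; first by rewrite xz' eqxx in xz.
have /andP[l0 l1] := tree_label_bounds xz.
have [_ dxp _] := parent_link hier xz.
have /andP[k1 kL] := level_bounds hier xz.
have hl0 : 0 <= h (tree_label lev x) by apply: chaining_ge0 => //; lra.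
apply: (@le_trans _ _ (2 * radius (lev x).-1 * h (tree_label lev x))).
  by rewrite ler_wpM2r.
move: kL; rewrite /level_cost leq_eqVlt => /predU1P[kL|kL]; last first.
  rewrite kL; have -> : 2 * radius (lev x).-1 = 16 * radius (lev x).
    move: k1 kL {mx dxp l0 l1 hl0}; case: (lev x) => [//|[//|k]] _ kL.
    by rewrite [scale R L k.+2]scaleS//=; lra.
  apply: ler_wpM2l; first by rewrite mulr_ge0.
  have /andP[q0 q1] := q_bounds (lev x).
  apply: le_trans _ (chaining_scale_growth q0 q1 kL).
  apply: chaining_antitone => //; [by rewrite mulr_gt0 ?scale_gt0| | lra].
  have s1 := scale1_le R L (ltnW k1); have s0 := scale_ge0 R L (lev x).
  rewrite /q /tree_label -/eps.
  case: (leP (ball_mass y (radius (lev x) / 2)) eps) => _.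
    have := mulr_ge0 (mass_ge0 rho_prob (cball d x (radius (lev x)))) s0.
    by have := ler_wpM2r (ltW eps_gt0) s1; lra.
  by have := ler_wpM2r s0 mx; move: eps_gt0; lra.
rewrite kL ltnn -{1}kL; have -> : tree_label lev x = eps.
  by rewrite /tree_label kL scaleL mulr0 add0r.
have heps : h eps <= 8 * #|X|%:R.
  have := chaining_growth h_lc h_normalized ltr01 (lexx 1)
    (_ : 0 <= 8 * #|X|%:R - 1).
  rewrite subrKC (chaining1 h_lc h_normalized) add0r -/eps => H.
  by apply: le_trans (H _) _; move: X_gt0; lra.
rewrite kL; have s0 := scale_ge0 R L L.-1.
apply: (@le_trans _ _ (2 * radius L.-1 * (8 * #|X|%:R))).
  by apply: ler_wpM2l; rewrite ?mulr_ge0 ?scale_ge0.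
have := ler_wpM2l D_ge0 last_scale; lra.
Qed.

Let pot x : R := \sum_(2 <= k < (lev x).+1) level_cost k.

Lemma path_length_le_levels :
  path_length h d (parent_tree z par (tree_label lev)) y <=
  \sum_(2 <= k < L.+1) level_cost k.
Proof.
have pot_ge0 x : 0 <= pot x.
  by rewrite /pot sumr_ge0// => k _; exact: level_cost_ge0.
apply: (@le_trans _ _ (pot y)).
  apply: (@path_length_le _ _ _ lev par _ par_lev h d near_point pot) => //.
  - exact: near_parent.
  - move=> x xz nx; have /andP[k1 _] := level_bounds hier xz.
    rewrite /pot [leRHS]big_nat_recr//= [leRHS]addrC lerD ?edge_cost_le//.
    have [/andP[p0 pk] _ _] := parent_link hier xz.
    rewrite (@big_cat_nat _ _ _ (lev (par x)).+1 2 (lev x))//= lerDl.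
    by rewrite sumr_ge0// => k _; exact: level_cost_ge0.
  - exact: near_self.
rewrite /pot; have [yz|yz] := eqVneq y z.
  rewrite yz (level_root hier) big_geq// sumr_ge0// => k _.
  exact: level_cost_ge0.
have /andP[k1 kL] := level_bounds hier yz.
rewrite [leRHS](@big_cat_nat _ _ _ (lev y).+1)//=; last exact: ltnW.
by rewrite lerDl sumr_ge0// => k _; exact: level_cost_ge0.
Qed.

Let A : R := \sum_(2 <= k < L) (radius k / 2 - radius k.+1 / 2) * h (q k).

Lemma riemann_sum_le_gamma : (A%:E <= gamma_h h d rho)%E.
Proof.
have := @riemann_le_gamma _ _ d rho d_metric rho_prob h h_lc y
  (fun k => radius k / 2) (fun r => h (Num.max (ball_mass y r) eps)) 2 L L_ge2.
apply.
- by rewrite divr_ge0.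
- move=> k /andP[k2 kL]; rewrite ler_pM2r ?invr_gt0// ler_wpM2l//.
  by apply: scale_antitone; rewrite // ltnW.
- move=> r r0; have m0 := mass_ge0 rho_prob (cball d y r).
  have m1 := mass_le1 rho_prob (cball d y r).
  have e1 : eps <= 1 by move: eps_le; lra.
  have q0 : 0 < Num.max (ball_mass y r) eps by rewrite lt_max eps_gt0 orbT.
  have q1 : Num.max (ball_mass y r) eps <= 1 by rewrite ge_max m1 e1.
  split; first exact: chaining_ge0.
  by apply: le_ext0; rewrite // le_max lexx.
Qed.

(** The radii r_k/2 decrease by a factor of at least 8, so that r_k/2 is at most
    8/7 of the gap to the next one; and 37 > 32 * 8/7. *)
Lemma sum_level_cost_le :
  \sum_(2 <= k < L.+1) level_cost k <= 37 * A + 128 * D.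
Proof.
rewrite big_nat_recr//= {2}/level_cost ltnn.
have -> : 37 * A + 128 * D = (37 * A + 112 * D) + 16 * D by lra.
rewrite lerD2r.
pose bound k := 37 * ((radius k / 2 - radius k.+1 / 2) * h (q k)) +
  112 * (D * (scale R L k * k.-1%:R)).
have H k : (1 < k < L)%N -> level_cost k <= bound k.
  move=> /andP[k1 kL]; rewrite /level_cost /bound kL.
  have r1 : radius k.+1 <= radius k / 8.
    by rewrite -mulrA ler_wpM2l// scaleS_le// ltnW.
  have r2 : 16 * radius k <= 37 * (radius k / 2 - radius k.+1 / 2).
    have := radius_ge0 k; lra.
  have := ler_wpM2r (hq_ge0 k) r2; lra.
apply: (@le_trans _ _ (\sum_(2 <= k < L) bound k)).
  rewrite big_nat_cond [leRHS]big_nat_cond ler_sum// => k.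
  by rewrite andbT; exact: H.
rewrite big_split/= -!mulr_sumr lerD2l ler_wpM2l//.
by rewrite ler_piMr// sum_scale_level.
Qed.

End FromOnePoint.

Hypothesis D_le : ((D / 8)%:E <= gamma_h h d rho)%E.

(** The levels cost at most 37 times a lower Riemann sum of the integral plus
    128 D, and D is at most 8 times the value of the measure. *)
Lemma val_le_gamma (K : R) : 37 + 128 * 8 <= K ->
  ((val_h h d (parent_tree z par (tree_label lev)))%:E <=
    K%:E * gamma_h h d rho)%E.
Proof.
move=> hK; have K0 : 0 < K by lra.
have := D_le; set g := gamma_h h d rho => Dg.
have g0 : (0 <= g)%E by apply: le_trans Dg; rewrite lee_fin divr_ge0.
have [gy|gfin] := eqVneq g +oo%E.
  by rewrite gy gt0_muley ?leey// lte_fin.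
have {gfin} [c cE] : exists c, g = c%:E.
  by case: g g0 gfin {Dg} => // c; exists c.
move: g0 Dg; rewrite cE -EFinM !lee_fin => c0 Dc.
apply/bigmax_le => [|y _]; first by rewrite mulr_ge0// ltW.
apply: le_trans (path_length_le_levels y) _.
apply: le_trans (sum_level_cost_le y) _.
have := riemann_sum_le_gamma y; rewrite -/g cE lee_fin => Ac.
by have := ler_wpM2r c0 hK; lra.
Qed.

Lemma chaining_tree_hierarchy :
  is_chaining_tree (parent_tree z par (tree_label lev)).
Proof.
split; first exact: parent_tree_spanning par_lev.
- move=> e /imsetP[x]; rewrite inE => xz ->.
  by rewrite (label_parent_edge _ par_lev xz) tree_label_bounds.
- by rewrite (sum_parent_tree _ par_lev id) sum_tree_label.
Qed.

End Hierarchy.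

(** * Running programs within a time bound *)

Section Runs.
Variables (R : realType) (h : R -> R).
Implicit Types (s : state R) (c : cmd) (T : nat) (Q : state R -> Prop).

Definition runs c s T Q :=
  exists t s', [/\ exec h c s t s', (t <= T)%N & Q s'].

Lemma runs_weaken c s T T' Q Q' : (T <= T')%N -> (forall s', Q s' -> Q' s') ->
  runs c s T Q -> runs c s T' Q'.
Proof.
move=> TT' QQ' [t [s' [e tT q]]]; exists t, s'; split=> //.
  exact: leq_trans TT'.
exact: QQ'.
Qed.

Lemma runs_skip s T Q : (0 < T)%N -> Q s -> runs CSkip s T Q.
Proof. by move=> T0 q; exists 1%N, s; split=> //; exact: ExecSkip. Qed.

Lemma runs_seti s a i e T Q : (icost i + icost e < T)%N ->
  Q (State (upd (imem s) a (ieval s i) (ieval s e)) (rmem s)) ->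
  runs (CSetI a i e) s T Q.
Proof. by move=> T0 q; eexists; eexists; split; first exact: ExecSetI. Qed.

Lemma runs_setr s a i e T Q : (icost i + rcost e < T)%N ->
  Q (State (imem s) (upd (rmem s) a (ieval s i) (reval h s e))) ->
  runs (CSetR a i e) s T Q.
Proof. by move=> T0 q; eexists; eexists; split; first exact: ExecSetR. Qed.

Lemma runs_seq c1 c2 s T1 T2 T Q : (T1 + T2 <= T)%N ->
  runs c1 s T1 (fun s' => runs c2 s' T2 Q) -> runs (CSeq c1 c2) s T Q.
Proof.
move=> TT [t1 [s1 [e1 tT1 [t2 [s2 [e2 tT2 q]]]]]].
exists (t1 + t2)%N, s2; split=> //; first exact: ExecSeq e1 e2.
by apply: leq_trans TT; exact: leq_add.
Qed.

Lemma runs_if b c1 c2 s T Q : (bcost b < T)%N ->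
  (beval h s b -> runs c1 s (T - (bcost b).+1) Q) ->
  (~~ beval h s b -> runs c2 s (T - (bcost b).+1) Q) ->
  runs (CIf b c1 c2) s T Q.
Proof.
move=> bT H1 H2; case: (boolP (beval h s b)) => hb.
  have [t [s' [e tT q]]] := H1 hb; exists (bcost b + t).+1, s'.
  by split=> //; [exact: ExecIfTrue | lia].
have [t [s' [e tT q]]] := H2 hb; exists (bcost b + t).+1, s'.
by split=> //; [exact: ExecIfFalse | lia].
Qed.

(** The number [N] of iterations is fixed in advance, which makes the loop count
    part of the time bound. *)
Lemma runs_while b c s T N (Inv : nat -> state R -> Prop) :
  Inv 0%N s ->
  (forall i s', (i < N)%N -> Inv i s' ->
    beval h s' b /\ runs c s' T (Inv i.+1)) ->
  (forall s', Inv N s' -> ~~ beval h s' b) ->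
  runs (CWhile b c) s (N * (T + (bcost b).+1) + (bcost b).+1) (Inv N).
Proof.
move=> + body stop.
have H j : (j <= N)%N -> forall s', Inv (N - j)%N s' ->
    runs (CWhile b c) s' (j * (T + (bcost b).+1) + (bcost b).+1) (Inv N).
  elim: j => [|j IH] jN s' inv.
    rewrite subn0 in inv; exists (bcost b).+1, s'; split=> //.
    exact: ExecWhileDone (stop _ inv).
  have jlt : (N - j.+1 < N)%N by lia.
  have [hb [t1 [s1 [e1 tT1 inv1]]]] := body _ _ jlt inv.
  have e : (N - j.+1).+1 = (N - j)%N by lia.
  rewrite e in inv1.
  have [t2 [s2 [e2 tT2 inv2]]] := IH (ltnW jN) _ inv1.
  exists (bcost b + t1 + t2).+1, s2; split=> //.
    exact: ExecWhileStep e1 e2.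
  by rewrite mulSn; lia.
by move=> inv0; apply: H => //; rewrite subnn.
Qed.

Fixpoint iwrites c : seq nat :=
  match c with
  | CSkip | CSetR _ _ _ => [::]
  | CSetI a _ _ => [:: a]
  | CSeq c1 c2 | CIf _ c1 c2 => iwrites c1 ++ iwrites c2
  | CWhile _ c1 => iwrites c1
  end.

Fixpoint rwrites c : seq nat :=
  match c with
  | CSkip | CSetI _ _ _ => [::]
  | CSetR a _ _ => [:: a]
  | CSeq c1 c2 | CIf _ c1 c2 => rwrites c1 ++ rwrites c2
  | CWhile _ c1 => rwrites c1
  end.

(** Frame conditions: [li] and [lr] list the arrays that may have changed. *)
Definition same_off (li lr : seq nat) s s' : Prop :=
  (forall a, a \notin li -> imem s' a = imem s a) /\
  (forall a, a \notin lr -> rmem s' a = rmem s a).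

Lemma same_off_trans li lr s1 s2 s3 :
  same_off li lr s1 s2 -> same_off li lr s2 s3 -> same_off li lr s1 s3.
Proof.
move=> [i1 r1] [i2 r2].
by split=> a al; [rewrite i2 ?i1 | rewrite r2 ?r1].
Qed.

Lemma same_off_sub li lr li' lr' s s' : {subset li <= li'} ->
  {subset lr <= lr'} -> same_off li lr s s' -> same_off li' lr' s s'.
Proof.
move=> ii rr [i1 r1].
by split=> a al; [apply/i1/(contra (@ii a)) | apply/r1/(contra (@rr a))].
Qed.

Lemma exec_same_off c s t s' : exec h c s t s' ->
  same_off (iwrites c) (rwrites c) s s'.
Proof.
elim=> {c s t s'} //=.
- move=> s a i e; split=> // b; rewrite inE => /negbTE ba.
  by apply/funext => j /=; rewrite /upd ba.
- move=> s a i e; split=> // b; rewrite inE => /negbTE ba.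
  by apply/funext => j /=; rewrite /upd ba.
- move=> s s1 s2 t1 t2 c1 c2 _ H1 _ H2.
  by apply: same_off_trans (same_off_sub _ _ H1) (same_off_sub _ _ H2);
    move=> x; rewrite mem_cat => ->; rewrite ?orbT.
- move=> s s1 t b c1 c2 _ _ H.
  by apply: same_off_sub H; move=> x; rewrite mem_cat => ->.
- move=> s s1 t b c1 c2 _ _ H.
  by apply: same_off_sub H; move=> x; rewrite mem_cat => ->; rewrite orbT.
- by move=> s s1 s2 t1 t2 b c _ _ H1 _ H2; exact: same_off_trans H1 H2.
Qed.

Lemma runs_frame c s T Q : runs c s T Q ->
  runs c s T (fun s' => Q s' /\ same_off (iwrites c) (rwrites c) s s').
Proof.
move=> [t [s' [e tT q]]]; exists t, s'; split=> //.
by split=> //; exact: exec_same_off e.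
Qed.

Lemma upd_same (V : Type) (m : nat -> nat -> V) a k v : upd m a k v a k = v.
Proof. by rewrite /upd !eqxx. Qed.

Lemma upd_other (V : Type) (m : nat -> nat -> V) a k v b l :
  (b != a) || (l != k) -> upd m a k v b l = m b l.
Proof. by rewrite /upd -negb_and => /negbTE ->. Qed.

Lemma upd_off (V : Type) (m : nat -> nat -> V) (l : seq nat) a b k v :
  b \in l -> a \notin l -> upd m b k v a = m a.
Proof.
move=> bl al; apply/funext => j; rewrite /upd.
by case: eqP => // ab; rewrite ab bl in al.
Qed.

Definition iget a : iexp := IGet a (IConst 0).
Definition rget a : rexp := RGet a (IConst 0).
Definition iset a e : cmd := CSetI a (IConst 0) e.
Definition rset a e : cmd := CSetR a (IConst 0) e.

(** The bound of every counted loop is the input size, held in array 0. *)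
Definition for_loop v c : cmd :=
  CSeq (iset v (IConst 0))
    (CWhile (BNot (BLeI (iget 0) (iget v)))
      (CSeq c (iset v (IAdd (iget v) (IConst 1))))).

Definition set_counter s v i : state R :=
  State (upd (imem s) v 0 i) (rmem s).

(** The invariant may use that everything outside the arrays written by the
    body is as it was before the loop.  The constant 20 pays for the counter and
    the test. *)
Lemma runs_for v c s T n (Inv : nat -> state R -> Prop) T' Q :
  (n * (T + 20) + 20 <= T')%N -> imem s 0 0 = n -> v != 0%N ->
  0%N \notin iwrites c -> v \notin iwrites c ->
  Inv 0%N (set_counter s v 0) ->
  (forall i s', (i < n)%N ->
    same_off (v :: iwrites c) (rwrites c) s s' -> imem s' v 0 = i ->
    Inv i s' ->
    runs c s' T (fun s2 => Inv i.+1 (set_counter s2 v i.+1))) ->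
  (forall s', Inv n s' -> same_off (v :: iwrites c) (rwrites c) s s' -> Q s') ->
  runs (for_loop v c) s T' Q.
Proof.
move=> TT' nE v0 c0 cv inv0 body invQ.
pose Inv' i s' := [/\ same_off (v :: iwrites c) (rwrites c) s s',
  imem s' v 0 = i & Inv i s'].
apply: (@runs_seq _ _ _ 10 (n * (T + 20) + 10)); first by lia.
apply: runs_seti => //=; rewrite -/(set_counter s v 0).
have same_set s1 i :
    same_off (v :: iwrites c) (rwrites c) s1 (set_counter s1 v i).
  split=> // a; rewrite inE negb_or => /andP[/negbTE av _].
  by apply/funext => j; rewrite /= /upd av.
have set_v s1 i : imem (set_counter s1 v i) v 0 = i by rewrite /= /upd !eqxx.
apply: (@runs_weaken _ _ (n * ((T + 10) + 7) + 7)%N _ (Inv' n)).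
- by lia.
- by move=> s' [so _ inv]; exact: invQ.
apply: (@runs_while _ _ _ (T + 10) n Inv').
- by split.
- move=> i s' i_n [so vi inv]; split.
    have [/(_ 0%N) i0 _] := so.
    by rewrite /= i0 ?nE ?vi -?ltnNge// inE negb_or eq_sym v0.
  apply: (@runs_seq _ _ _ T 10) => //.
  apply: runs_weaken (runs_frame (body _ _ i_n so vi inv)) => // s1 [inv1 so1].
  apply: runs_seti => //=.
  have -> : imem s1 v 0 = i by rewrite so1.1.
  rewrite addn1 -/(set_counter s1 v i.+1); split=> //.
  apply: same_off_trans so _; apply: same_off_trans (same_set s1 _).
  by apply: same_off_sub so1 => // x xc; rewrite inE xc orbT.
- move=> s' [so vi _]; have [/(_ 0%N) i0 _] := so.
  by rewrite /= i0 ?nE ?vi ?leqnn// inE negb_or eq_sym v0.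
Qed.

End Runs.

(** * Greedy covering of one level *)

Section PartialHierarchy.
Variables (R : realType) (X : finType) (d : X -> X -> R) (rho : X -> R).
Variables (D : R) (L : nat) (z : X).
Hypotheses (d_metric : is_metric d) (D_ge0 : 0 <= D).
Hypothesis z_far : forall x, d z x <= D.

Local Notation radius k := (D * scale R L k).
Local Notation ball_mass x r := (mass rho (cball d x r)).
Local Notation link := (link d rho D L).
Local Notation tree_label := (tree_label d rho D L).

(** [tlev x] is 0 as long as [x] is not in the tree; [tcov x] is the last level
    at which [x] has been covered, and [tpi x] the centre that covered it. *)
Record tables := Tables {
  tlev : X -> nat; tcov : X -> nat; tpi : X -> X; tpar : X -> X }.

(** The invariant while the net of level [k] is being chosen.  A point that is
    already covered is linked to its centre as if it were to enter at level
    [k.+1], the others still as for level [k]. *)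
Record partial_hierarchy (k : nat) (t : tables) : Prop := PartialHierarchy {
  partial_root : tlev t z = 1%N;
  partial_bounds : forall x, [/\ (tcov t x <= k)%N, (tlev t x <= k)%N
    & tlev t x = k -> tcov t x = k];
  partial_net : forall x,
    link (tlev t) (if tcov t x == k then k.+1 else k) x (tpi t x);
  partial_parent : forall x, x != z -> (0 < tlev t x)%N ->
    (1 < tlev t x)%N /\ link (tlev t) (tlev t x) x (tpar t x);
  partial_separated : forall x y, x != y -> (1 < tlev t x)%N ->
    tlev t x = tlev t y -> 2 * radius (tlev t x) < d x y;
  partial_uncovered : forall x y, tlev t x = k -> (tcov t y < k)%N ->
    2 * radius k < d x y }.

Definition tables_attach (k : nat) (b : X) (t : tables) : tables :=
  let new x := (x == b) && (tlev t b == 0%N) in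
  Tables (fun x => if new x then k else tlev t x) (tcov t) (tpi t)
    (fun x => if new x then tpi t x else tpar t x).

Definition tables_cover (k : nat) (b : X) (t : tables) : tables :=
  let hit y := (tcov t y < k)%N && (d b y <= 2 * radius k) in
  Tables (tlev t) (fun y => if hit y then k else tcov t y)
    (fun y => if hit y then b else tpi t y) (tpar t).

Definition tables_step (k : nat) (b : X) (t : tables) : tables :=
  tables_cover k b (tables_attach k b t).

(** An uncovered point is farther than twice the radius from the centres chosen
    before, so that it may become a centre; as the heaviest such point, it is a
    legitimate parent for whatever it covers. *)
Lemma partial_step k b t : (1 < k)%N -> partial_hierarchy k t ->
  (tcov t b < k)%N ->
  (forall x, (tcov t x < k)%N ->
    ball_mass x (radius k) <= ball_mass b (radius k)) ->
  partial_hierarchy k (tables_step k b t).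
Proof.
move=> k1 [lz bnd net par sep unc] bk bmax.
have [_ d0 ds _] := d_metric.
have r0 : 0 <= 2 * radius k by rewrite !mulr_ge0// scale_ge0.
have dbb : d b b <= 2 * radius k by rewrite (d0 b b).2.
have lev_old x : (0 < tlev t x)%N -> tlev (tables_step k b t) x = tlev t x.
  move=> lx /=; case: andP => // -[/eqP xb /eqP b0].
  by move: lx; rewrite xb b0.
have link_old j x p :
    link (tlev t) j x p -> link (tlev (tables_step k b t)) j x p.
  by move=> [/andP[p0 pj] dxp mxp]; split; rewrite ?lev_old ?p0.
have lev_b : (0 < tlev (tables_step k b t) b < k.+1)%N.
  rewrite /= eqxx /=; case: eqP => [_|/eqP]; first by rewrite ltnSn (ltnW k1).
  by rewrite -lt0n => ->; have [] := bnd b.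
have lev_new x : ~~ ((x == b) && (tlev t b == 0%N)) ->
  tlev (tables_step k b t) x = tlev t x by move=> /negbTE /= ->.
split.
- by rewrite lev_old lz.
- move=> x; have [cx lx lkx] := bnd x; split.
  + by rewrite /=; case: ifP.
  + by rewrite /=; case: ifP.
  + have [/andP[/eqP -> _] _|nx] := boolP ((x == b) && (tlev t b == 0%N)).
      by rewrite /= bk dbb.
    by rewrite lev_new// => /lkx xk; rewrite /= xk ltnn.
- move=> x; rewrite [tpi _ _]/= [tcov (tables_step _ _ _) _]/=.
  have [/andP[xk dbx]|_] := boolP (_ && _); last exact: link_old (net x).
  by rewrite eqxx; split=> //; [rewrite ds | move=> _; exact: bmax].
- move=> x xz.
  have [/andP[/eqP xb b0]|nx] := boolP ((x == b) && (tlev t b == 0%N)).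
    move=> _; have -> : tlev (tables_step k b t) x = k by rewrite /= xb eqxx b0.
    rewrite [tpar _ _]/= {2}xb eqxx b0; split=> //.
    by have := net x; rewrite xb ltn_eqF//; exact: link_old.
  rewrite lev_new// [tpar _ _]/= (negbTE nx) => lx.
  by have [l1 lk] := par x xz lx; split=> //; exact: link_old.
- move=> x y xy.
  have [/andP[/eqP xb b0]|nx] := boolP ((x == b) && (tlev t b == 0%N)).
    have -> : tlev (tables_step k b t) x = k by rewrite /= xb eqxx b0.
    have [/andP[/eqP yb _]|ny] := boolP ((y == b) && (tlev t b == 0%N)).
      by rewrite xb yb eqxx in xy.
    rewrite lev_new// => _ ky; rewrite ds; apply: unc => //.
    by rewrite xb.
  have [/andP[/eqP yb b0]|ny] := boolP ((y == b) && (tlev t b == 0%N)).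
    have -> : tlev (tables_step k b t) y = k by rewrite /= yb eqxx b0.
    by rewrite lev_new// => _ xk; rewrite xk; apply: unc; rewrite // yb.
  rewrite !lev_new//; exact: sep.
- move=> x y.
  have [/andP[/eqP xb b0] _|nx] := boolP ((x == b) && (tlev t b == 0%N)).
    rewrite xb /=; case: ifP; first by rewrite ltnn.
    by move=> /negbT; rewrite negb_and -leqNgt => /orP[yk|];
      [rewrite ltnNge yk | rewrite -ltNge].
  rewrite lev_new// => xk yk; apply: unc => //.
  by move: yk => /=; case: ifP; rewrite ?ltnn.
Qed.

Lemma partial_next k t : (0 < k)%N -> partial_hierarchy k t ->
  (forall x, tcov t x = k) -> partial_hierarchy k.+1 t.
Proof.
move=> k0 [lz bnd net par sep unc] full; split=> //.
- move=> x; have [cx lx lkx] := bnd x; split; rewrite ?leqW//.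
  by move=> lk; rewrite lk ltnn in lx.
- by move=> x; have := net x; rewrite full eqxx ltn_eqF.
- by move=> x y xk; have [_ + _] := bnd x; rewrite xk ltnn.
Qed.

(** At scale 0 a covered point coincides with its centre, hence is in the
    tree. *)
Lemma partial_complete t : partial_hierarchy L t -> (1 < L)%N ->
  (forall x, tcov t x = L) -> hierarchy d rho D L z (tlev t) (tpar t).
Proof.
move=> [lz bnd net par sep unc] L1 full.
have lev0 x : (0 < tlev t x)%N.
  have := net x; rewrite full eqxx => -[/andP[p0 _] + _].
  rewrite /= scaleL !mulr0; have [dp d0 _ _] := d_metric => dxp.
  suff -> : x = tpi t x by [].
  by apply/d0/eqP; rewrite eq_le dxp dp.
split=> //.
- move=> x xz; have [l1 _] := par x xz (lev0 x).
  by have [_ -> _] := bnd x; rewrite l1.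
- by move=> x xz; have [_] := par x xz (lev0 x).
Qed.

(** The ball of radius [D] about the root is the whole space, hence as heavy as
    any other. *)
Lemma partial_init t : tlev t z = 1%N -> (forall x, x != z -> tlev t x = 0%N) ->
  (forall x, tcov t x = 0%N) -> (forall x, tpi t x = z) -> (1 < L)%N ->
  is_probability rho -> partial_hierarchy 2 t.
Proof.
move=> lz lx cx px L1 rho_prob; have [_ _ ds _] := d_metric.
have lev1 x : (tlev t x <= 1)%N.
  by have [->|/lx ->] := eqVneq x z; rewrite ?lz.
have r1 : radius 1 = D by rewrite scale_ltL// expr0 mulr1.
split=> //.
- move=> x; rewrite cx; split=> //; first exact: leqW.
  by move=> x2; have := lev1 x; rewrite x2.
- move=> x; rewrite cx px; split=> /=; rewrite ?lz// ?r1.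
    by rewrite ds (le_trans (z_far x))// ler_peMl// ler1n.
  move=> _; apply: (le_mass rho_prob); apply/fintype.subsetP => y _.
  by rewrite inE.
- by move=> x /lx ->.
- by move=> x y _; have := lev1 x; rewrite leqNgt => /negbTE ->.
- by move=> x y x2; have := lev1 x; rewrite x2.
Qed.

End PartialHierarchy.

(** * The program and its verification *)

(** Integer arrays.  The first four are those of the input and output; as the
    root is vertex 0, the edge above a vertex x is kept in slot x - 1. *)
Local Notation aN := 0%N.
Local Notation aRoot := 1%N.
Local Notation aFrom := 2%N.
Local Notation aTo := 3%N.
Local Notation aLev := 4%N.
Local Notation aPi := 5%N.
Local Notation aCov := 6%N.
Local Notation vI := 7%N.
Local Notation vJ := 8%N.
Local Notation vBest := 9%N.
Local Notation vK := 10%N.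

(** Real arrays: 0 and 1 are input, 2 is output. *)
Local Notation rDist := 0%N.
Local Notation rRho := 1%N.
Local Notation rLab := 2%N.
Local Notation rMass := 3%N.
Local Notation rScale := 4%N.
Local Notation rDiam := 5%N.
Local Notation rSize := 6%N.
Local Notation rTop := 7%N.

Definition dist_at i : rexp :=
  RGet rDist (IAdd (IMul i (iget aN)) (iget vJ)).
Definition radius_exp : rexp := RMul (rget rDiam) (rget rScale).
(** Coverage is recorded by level, so that it lapses when the level counter
    moves on. *)
Definition uncovered_exp : bexp := BNot (BLeI (iget vK) (IGet aCov (iget vJ))).

(** A real copy of the size is obtained by counting, as integers cannot be
    converted. *)
Definition measure_input : cmd :=
  for_loop vJ
    (CSeq (rset rSize (RAdd (rget rSize) (RConst 1)))
      (CIf (BLeR (rget rDiam) (RGet rDist (iget vJ)))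
        (rset rDiam (RGet rDist (iget vJ))) CSkip)).

Definition ball_masses : cmd :=
  for_loop vI
    (CSeq (CSetR rMass (iget vI) (RConst 0))
      (for_loop vJ
        (CIf (BLeR (dist_at (iget vI)) radius_exp)
          (CSetR rMass (iget vI)
            (RAdd (RGet rMass (iget vI)) (RGet rRho (iget vJ))))
          CSkip))).

Definition select_heaviest : cmd :=
  CSeq (iset vBest (iget aN)) (CSeq (rset rTop (RConst 0))
    (for_loop vJ
      (CIf (BAnd uncovered_exp (BLeR (rget rTop) (RGet rMass (iget vJ))))
        (CSeq (iset vBest (iget vJ)) (rset rTop (RGet rMass (iget vJ))))
        CSkip))).

Definition attach : cmd :=
  let slot := ISub (iget vBest) (IConst 1) in
  CIf (BLeI (IGet aLev (iget vBest)) (IConst 0))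
    (CSeq (CSetI aLev (iget vBest) (iget vK))
    (CSeq (CSetI aFrom slot (iget vBest))
    (CSeq (CSetI aTo slot (IGet aPi (iget vBest)))
      (CSetR rLab slot
        (RAdd (RMul (RGet rMass (iget vBest)) (rget rScale))
          (RDiv (RConst 1) (RMul (RConst 8) (rget rSize))))))))
    CSkip.

Definition cover : cmd :=
  for_loop vJ
    (CIf (BAnd uncovered_exp
        (BLeR (dist_at (iget vBest)) (RMul (RConst 2) radius_exp)))
      (CSeq (CSetI aCov (iget vJ) (iget vK))
        (CSetI aPi (iget vJ) (iget vBest)))
      CSkip).

Definition net_round : cmd :=
  CSeq select_heaviest
    (CIf (BLeI (iget aN) (iget vBest)) CSkip (CSeq attach cover)).

Definition build_level : cmd := CSeq ball_masses (for_loop vI net_round).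

(** The loop stops when the previous scale is at most 1/n; a last pass at
    scale 0 then attaches all remaining points. *)
Definition tree_program : cmd :=
  CSeq measure_input
  (CSeq (CSetI aLev (IConst 0) (IConst 1))
  (CSeq (iset vK (IConst 2))
  (CSeq (rset rScale (RDiv (RConst 1) (RConst 8)))
  (CSeq
    (CWhile (BNot (BLeR
        (RMul (RMul (RConst 8) (rget rScale)) (rget rSize)) (RConst 1)))
      (CSeq build_level
      (CSeq (rset rScale (RDiv (rget rScale) (RConst 8)))
        (iset vK (IAdd (iget vK) (IConst 1))))))
  (CSeq (rset rScale (RConst 0)) build_level))))).

Section Program.
Variables (R : realType) (h : R -> R) (n : nat).
Variables (d : 'I_n -> 'I_n -> R) (rho : 'I_n -> R).
Hypotheses (d_metric : is_metric d) (rho_prob : is_probability rho).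
Variables (D : R) (L : nat) (z : 'I_n).
Hypothesis z0 : z = 0%N :> nat.
Hypothesis D_ge0 : 0 <= D.
Hypothesis z_far : forall x, d z x <= D.

Local Notation radius k := (D * scale R L k).
Local Notation ball_mass x r := (mass rho (cball d x r)).
Implicit Types (s : state R) (x y : 'I_n) (t : tables 'I_n).

Record has_input s : Prop := HasInput {
  input_size : imem s aN 0 = n;
  input_dist : forall i j : 'I_n, rmem s rDist (i * n + j) = d i j;
  input_mass : forall i : 'I_n, rmem s rRho i = rho i }.

Record has_context s : Prop := HasContext {
  context_input :> has_input s;
  context_diam : rmem s rDiam 0 = D;
  context_size : rmem s rSize 0 = n%:R }.

Lemma has_input_off li lr s s' : aN \notin li -> rDist \notin lr ->
  rRho \notin lr -> same_off li lr s s' -> has_input s -> has_input s'.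
Proof. by move=> h1 h2 h3 [hi hr] [*]; split=> *; rewrite ?hi ?hr. Qed.

Lemma has_context_off li lr s s' : aN \notin li -> rDist \notin lr ->
  rRho \notin lr -> rDiam \notin lr -> rSize \notin lr ->
  same_off li lr s s' -> has_context s -> has_context s'.
Proof.
move=> h1 h2 h3 h4 h5 so [hin hd hs].
split; [exact: has_input_off so hin | by rewrite so.2 | by rewrite so.2].
Qed.

Lemma sum_prefixS (F : 'I_n -> R) (j : 'I_n) :
  \sum_(y < n | (y < j.+1)%N) F y = \sum_(y < n | (y < j)%N) F y + F j.
Proof.
rewrite (bigD1 j)//= addrC; congr (_ + _); apply: eq_bigl => y.
by rewrite ltnS [in RHS]ltn_neqAle andbC.
Qed.

Lemma runs_ball_masses s r : has_context s -> D * rmem s rScale 0 = r ->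
  runs h ball_masses s (n * (n * 100 + 100) + 20)
    (fun s' => (forall x, rmem s' rMass x = ball_mass x r) /\
      same_off [:: vI; vJ; vJ] [:: rMass; rMass] s s').
Proof.
move=> ctx rE.
apply: (@runs_for _ _ _ _ _ (n * 60 + 60) n
  (fun i s' => forall x, (x < i)%N -> rmem s' rMass x = ball_mass x r)) => //.
- by lia.
- by case: ctx => [[]].
- move=> i s1 i_n so iE inv.
  have {}so : same_off [:: vI; vJ] [:: rMass] s s1.
    by apply: same_off_sub so => a; rewrite /= !inE; do ?case: eqP.
  have ctx1 : has_context s1 by apply: has_context_off so ctx.
  apply: (@runs_seq _ _ _ _ _ 10 (n * 60 + 50)); first by lia.
  apply: runs_setr => //=; rewrite iE.
  set s2 := State _ _.
  have so2 : same_off [::] [:: rMass] s1 s2.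
    by split=> // a al; rewrite /=; apply: upd_off al.
  have ctx2 : has_context s2 by apply: has_context_off so2 ctx1.
  pose oi := Ordinal i_n.
  pose F y := if d oi y <= r then rho y else 0.
  apply: (@runs_for _ _ _ _ _ 40 n
    (fun j s' => rmem s' rMass i = \sum_(y < n | (y < j)%N) F y /\
      forall l, l != i -> rmem s' rMass l = rmem s1 rMass l)) => //.
  + by lia.
  + by case: ctx2 => [[]].
  + rewrite /= upd_same big_pred0//; split=> // l li.
    by rewrite upd_other// li orbT.
  + move=> j s3 j_n so3 jE [sumE restE].
    have ctx3 : has_context s3 by apply: has_context_off so3 ctx2.
    have s3i : imem s3 vI 0 = i by rewrite so3.1// so2.1.
    have s3r : rmem s3 rScale 0 = rmem s rScale 0.
      by rewrite so3.2// so2.2// so.2.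
    have cond : beval h s3 (BLeR (dist_at (iget vI)) radius_exp) =
        (d oi (Ordinal j_n) <= r).
      rewrite /= s3i jE (input_size ctx3) (input_dist ctx3 oi (Ordinal j_n)).
      by rewrite (context_diam ctx3) s3r rE.
    apply: runs_if => //; rewrite cond => dr.
      apply: runs_setr => //=; rewrite s3i jE (input_mass ctx3 (Ordinal j_n)).
      rewrite (sum_prefixS F (Ordinal j_n)) -sumE upd_same /F dr.
      by split=> // l li; rewrite upd_other ?li ?orbT// restE.
    apply: runs_skip => //=.
    rewrite (sum_prefixS F (Ordinal j_n)) -sumE /F (negbTE dr) addr0.
    by split.
  + move=> s' [sumE restE] so3 x /=; rewrite ltnS leq_eqVlt => /predU1P[xi|xi].
      rewrite xi sumE /mass [RHS]big_mkcond /=.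
      have -> : x = oi by apply: val_inj.
      rewrite (eq_bigl xpredT); last by move=> y; rewrite ltn_ord.
      by apply: eq_bigr => y _; rewrite inE.
    by rewrite restE ?ltn_eqF// inv.
- by move=> s' inv so; split=> // x; exact: inv.
Qed.

Local Notation uncovered s k := [pred y : 'I_n | (imem s aCov y < k)%N].

Lemma runs_select s k : has_context s -> imem s vK 0 = k ->
  (forall x, 0 <= rmem s rMass x) ->
  runs h select_heaviest s (n * 80 + 60) (fun s' =>
    ((imem s' vBest 0 = n /\ uncovered s k =1 xpred0) \/
     exists b : 'I_n, [/\ imem s' vBest 0 = b, uncovered s k b &
       forall x, uncovered s k x -> rmem s rMass x <= rmem s rMass b]) /\
    same_off [:: vBest; vJ] [:: rTop] s s').
Proof.
move=> ctx kE m0.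
apply: (@runs_seq _ _ _ _ _ 10 (n * 80 + 50)); first by lia.
apply: runs_seti => //=; rewrite (input_size ctx).
apply: (@runs_seq _ _ _ _ _ 10 (n * 80 + 40)); first by lia.
apply: runs_setr => //=.
set s1 := State _ _.
have so1 : same_off [:: vBest; vJ] [:: rTop] s s1.
  by split=> a al; rewrite /=; apply: upd_off al.
have ctx1 : has_context s1 by apply: has_context_off so1 ctx.
apply: (@runs_for _ _ _ _ _ 50 n (fun j s' =>
    [/\ imem s' vBest 0 = n, rmem s' rTop 0 = 0 &
       forall x, (x < j)%N -> ~~ uncovered s k x] \/
    exists b : 'I_n, [/\ imem s' vBest 0 = b, rmem s' rTop 0 = rmem s rMass b,
       uncovered s k b &
       forall x, (x < j)%N -> uncovered s k x ->
         rmem s rMass x <= rmem s rMass b])) => //.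
- by lia.
- by case: ctx1 => [[]].
- by left; split=> //; rewrite /= upd_same.
- move=> j s2 j_n so2 jE inv.
  have {}so2 : same_off [:: vBest; vJ] [:: rTop] s s2.
    apply: same_off_trans so1 _; apply: same_off_sub so2 => a;
    by rewrite /= !inE; do ?case: eqP.
  pose oj := Ordinal j_n.
  have cond : beval h s2
        (BAnd uncovered_exp (BLeR (rget rTop) (RGet rMass (iget vJ)))) =
      uncovered s k oj && (rmem s2 rTop 0 <= rmem s rMass oj).
    by rewrite /= jE (so2.1 vK)// (so2.1 aCov)// (so2.2 rMass)// kE -ltnNge.
  apply: runs_if => //; rewrite cond.
    move=> /andP[uj top_le].
    apply: (@runs_seq _ _ _ _ _ 10 10) => //.
    apply: runs_seti => //=; apply: runs_setr => //=.
    rewrite [X in rmem s2 rMass X]upd_other// jE.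
    right; exists oj; rewrite !upd_same /= (so2.2 rMass)//; split=> // x.
    rewrite ltnS leq_eqVlt => /predU1P[xj _|xj ux].
      by have -> : x = oj by exact: val_inj.
    case: inv => [[_ _ none]|[b [_ topE _ bmax]]].
      by have := none x xj; rewrite /= ux.
    by apply: le_trans (bmax x xj ux) _; rewrite -topE.
  rewrite negb_and => nj.
  apply: runs_skip => //=.
  case: inv => [[bE topE none]|[b [bE topE ub bmax]]].
    left; split=> // x.
    rewrite ltnS leq_eqVlt => /predU1P[xj|]; last exact: none.
    have -> : x = oj by exact: val_inj.
    by case/orP: nj => //; rewrite topE m0.
  right; exists b; split=> // x.
  rewrite ltnS leq_eqVlt => /predU1P[xj|]; last exact: bmax.
  have -> : x = oj by [exact: val_inj]; move=> ux.
  by case/orP: nj; [rewrite /= ux | rewrite topE -ltNge => /ltW].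
- move=> s' inv so2; split.
    case: inv => [[bE _ none]|[b [bE _ ub bmax]]]; [left|right].
      by split=> // x; apply/negbTE/none.
    by exists b; split=> // x; apply: bmax.
  apply: same_off_trans so1 _; apply: same_off_sub so2 => a;
  by rewrite /= !inE; do ?case: eqP.
Qed.

(** An edge slot is meaningful once its vertex is in the tree. *)
Record stores s (t : tables 'I_n) : Prop := Stores {
  stores_lev : forall x, imem s aLev x = tlev t x;
  stores_cov : forall x, imem s aCov x = tcov t x;
  stores_pi : forall x, imem s aPi x = tpi t x;
  stores_edge : forall x, x != z -> (0 < tlev t x)%N ->
    [/\ imem s aFrom x.-1 = x, imem s aTo x.-1 = tpar t x
      & rmem s rLab x.-1 = tree_label d rho D L (tlev t) x] }.

Lemma stores_off li lr s s' t :
  all (fun a => a \notin li) [:: aLev; aCov; aPi; aFrom; aTo] ->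
  rLab \notin lr -> same_off li lr s s' -> stores s t -> stores s' t.
Proof.
move=> /= /and5P[h1 h2 h3 h4 /andP[h5 _]] h6 so [l c p e].
by split=> *; rewrite ?so.1// so.2//; exact: e.
Qed.

Let pos_neq_root x : x != z -> (0 < x)%N.
Proof.
by rewrite lt0n; apply: contraNneq => x0; apply/eqP/val_inj; rewrite /= x0 z0.
Qed.

Lemma runs_attach s k (b : 'I_n) t : has_context s -> imem s vK 0 = k ->
  imem s vBest 0 = b -> rmem s rScale 0 = scale R L k ->
  rmem s rMass b = ball_mass b (radius k) -> tlev t z = 1%N ->
  stores s t ->
  runs h attach s 100 (fun s' => stores s' (tables_attach k b t) /\
    same_off [:: aLev; aFrom; aTo] [:: rLab] s s').
Proof.
move=> ctx kE bE wE mE lz [sl sc sp se].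
apply: runs_if => //=; rewrite bE sl.
  rewrite leqn0 => b0.
  have bz : b != z by apply: contraTneq b0 => ->; rewrite lz.
  have b_pos := pos_neq_root bz.
  apply: (@runs_seq _ _ _ _ _ 10 70) => //; apply: runs_seti => //=.
  apply: (@runs_seq _ _ _ _ _ 10 60) => //; apply: runs_seti => //=.
  apply: (@runs_seq _ _ _ _ _ 10 50) => //; apply: runs_seti => //=.
  apply: runs_setr => //=.
  rewrite /upd /= bE kE wE mE sp subn1 (context_size ctx).
  split; last by split=> a; rewrite !inE ?negb_or => al; apply/funext => l /=;
    move: al; do ?case: eqP.
  split=> x /=; rewrite ?sl ?sc ?sp ?b0 ?andbT//.
  move=> xz lx; have x_pos := pos_neq_root xz.
  have -> : (x.-1 == b.-1) = (x == b).
    by rewrite -(inj_eq val_inj)/= -eqSS !prednK.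
  have [xb|xb] := eqVneq x b.
    rewrite xb; split=> //.
    by rewrite /tree_label /= ?eqxx ?b0 /= card_ord.
  move: lx; rewrite (negbTE xb) => lx; have [e1 e2 e3] := se x xz lx.
  split=> //; rewrite e3 /tree_label /=.
  by rewrite (negbTE xb).
rewrite -ltnNge => b0; apply: runs_skip => //; split=> //.
have bn : (tlev t b == 0%N) = false by rewrite eqn0Ngt b0.
split=> x; rewrite /= ?bn ?andbF// => xz lx.
have [e1 e2 e3] := se x xz lx; split=> //.
by rewrite e3 /tree_label /= ?bn ?andbF.
Qed.

Lemma runs_cover s k (b : 'I_n) t : has_context s -> imem s vK 0 = k ->
  imem s vBest 0 = b -> rmem s rScale 0 = scale R L k -> stores s t ->
  runs h cover s (n * 80 + 20) (fun s' =>
    stores s' (tables_cover d D L k b t) /\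
    same_off [:: vJ; aCov; aPi] [::] s s').
Proof.
move=> ctx kE bE wE [sl sc sp se].
pose hit (x : 'I_n) := (tcov t x < k)%N && (d b x <= 2 * radius k).
apply: (@runs_for _ _ _ _ _ 60 n (fun j s' =>
    (forall x, imem s' aCov x = if (x < j)%N && hit x then k else tcov t x) /\
    (forall x, imem s' aPi x = if (x < j)%N && hit x then b else tpi t x)))
  => //.
- by case: ctx => [[]].
- move=> j s1 j_n so jE [c1 p1].
  have ctx1 : has_context s1 by apply: has_context_off so ctx.
  pose oj := Ordinal j_n.
  have bE1 : imem s1 vBest 0 = b by rewrite so.1.
  have kE1 : imem s1 vK 0 = k by rewrite so.1.
  have wE1 : rmem s1 rScale 0 = scale R L k by rewrite so.2.
  have cond : beval h s1 (BAnd uncovered_exp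
        (BLeR (dist_at (iget vBest)) (RMul (RConst 2) radius_exp))) = hit oj.
    rewrite /= jE bE1 kE1 wE1 (context_diam ctx1) (input_size ctx1).
    by rewrite (input_dist ctx1 b oj) (c1 oj) ltnn -ltnNge.
  have step x : (x < j.+1)%N && hit x =
      ((x == oj) && hit oj) || ((x < j)%N && hit x).
    rewrite ltnS leq_eqVlt -[x == oj](inj_eq val_inj) /=.
    have [xj|] := eqVneq (x : nat) j; last by [].
    by have -> : x = oj by [exact: val_inj]; rewrite /= ltnn orbF.
  apply: runs_if => //; rewrite cond => hj.
    apply: (@runs_seq _ _ _ _ _ 10 20) => //; apply: runs_seti => //=.
    apply: runs_seti => //=.
    rewrite /upd /= jE bE1 kE1; split=> x; rewrite step hj andbT ?c1 ?p1;
      by rewrite -(inj_eq val_inj) /=; case: eqP.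
  apply: runs_skip => //=.
  by split=> x; rewrite upd_other// step (negbTE hj) andbF ?c1 ?p1.
- move=> s' [c1 p1] so; split=> //.
  split=> x; rewrite ?c1 ?p1 ?ltn_ord//; first by rewrite so.1.
  by move=> xz lx; rewrite !so.1// so.2//; exact: se.
Qed.

Record level_state s k t : Prop := LevelState {
  level_context :> has_context s;
  level_counter : imem s vK 0 = k;
  level_scale : rmem s rScale 0 = scale R L k;
  level_stores : stores s t;
  level_partial : partial_hierarchy d rho D L z k t }.

Lemma level_state_off li lr s s' k t :
  all (fun a => a \notin li) [:: aN; vK; aLev; aCov; aPi; aFrom; aTo] ->
  all (fun a => a \notin lr) [:: rDist; rRho; rDiam; rSize; rScale; rLab] ->
  same_off li lr s s' -> level_state s k t -> level_state s' k t.
Proof.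
move=> /= /and4P[i0 i1 i2 /and5P[i3 i4 i5 i6 _]].
move=> /and5P[r0 r1 r2 r3 /and3P[r4 r5 _]] so [ctx kE wE st pt]; split=> //.
- exact: has_context_off so ctx.
- by rewrite so.1.
- by rewrite so.2.
- by apply: stores_off so st => //=; rewrite i2 i3 i4 i5 i6.
Qed.

Lemma runs_net_round s k t : (1 < k)%N -> level_state s k t ->
  (forall x, rmem s rMass x = ball_mass x (radius k)) ->
  runs h net_round s (n * 160 + 220) (fun s' => exists t',
    [/\ level_state s' k t',
      (#|[pred y | tcov t' y < k]| <= #|[pred y | tcov t y < k]|.-1)%N
    & same_off [:: vBest; vJ; aLev; aFrom; aTo; aCov; aPi]
        [:: rTop; rLab] s s']).
Proof.
move=> k1 [ctx kE wE st pt] mE.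
apply: (@runs_seq _ _ _ _ _ (n * 80 + 60) (n * 80 + 160)); first by lia.
have m0 x : 0 <= rmem s rMass x by rewrite mE (mass_ge0 rho_prob).
apply: runs_weaken (runs_select ctx kE m0) => // s1 [best so1].
have ls1 : level_state s1 k t by apply: level_state_off so1 _.
case: ls1 => ctx1 kE1 wE1 st1 _.
have cov1 y : imem s aCov y = tcov t y by exact: stores_cov st y.
apply: runs_if => /=; [by lia | | ].
  rewrite (input_size ctx1) => nb; apply: runs_skip; first by lia.
  case: best => [[bE none]|[b [bE _ _]]]; last first.
    by rewrite bE leqNgt ltn_ord in nb.
  exists t; split=> //.
    rewrite (@eq_card0 _ [pred y | tcov t y < k]%N)// => y.
    by have := none y; rewrite !inE /= cov1.
  by apply: same_off_sub so1 => a; rewrite /= !inE; do ?case: eqP.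
rewrite (input_size ctx1) -ltnNge => bn.
case: best => [[bE none]|[b [bE]]]; first by rewrite bE ltnn in bn.
rewrite /= cov1 => ub bmax.
have [lz _ _ _ _ _] := pt.
apply: (@runs_seq _ _ _ _ _ 100 (n * 80 + 20)); first by lia.
have mE1 : rmem s1 rMass b = ball_mass b (radius k) by rewrite so1.2.
apply: runs_weaken (runs_attach ctx1 kE1 bE wE1 mE1 lz st1) => // s2 [st2 so2].
have ctx2 : has_context s2 by apply: has_context_off so2 ctx1.
have kE2 : imem s2 vK 0 = k by rewrite so2.1.
have bE2 : imem s2 vBest 0 = b by rewrite so2.1.
have wE2 : rmem s2 rScale 0 = scale R L k by rewrite so2.2.
apply: runs_weaken (runs_cover ctx2 kE2 bE2 wE2 st2) => // s3 [st3 so3].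
exists (tables_step d D L k b t); split.
- split=> //.
  + exact: has_context_off so3 ctx2.
  + by rewrite so3.1.
  + by rewrite so3.2.
  + apply: partial_step => // x ux; have := bmax x; rewrite !mE; apply.
    by rewrite cov1.
- rewrite [X in (_ <= X.-1)%N](cardD1 b) inE ub /=.
  apply/subset_leq_card/fintype.subsetP => y; rewrite !inE /=.
  case: ifP => [|/negbT]; first by rewrite ltnn.
  rewrite negb_and => nh uy; rewrite uy andbT.
  apply: contraTneq nh => ->; rewrite ub /= negbK.
  have [_ d0 _ _] := d_metric; rewrite (d0 b b).2//.
  by rewrite !mulr_ge0// scale_ge0.
- apply: same_off_trans (same_off_trans (same_off_sub _ _ so1)
    (same_off_sub _ _ so2)) (same_off_sub _ _ so3) => a;
  by rewrite /= !inE; do ?case: eqP.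
Qed.

(** Every round covers at least the point that it selects, so that [n] rounds
    cover everything. *)
Lemma runs_build_level s k t : (0 < n)%N -> (1 < k)%N -> level_state s k t ->
  runs h build_level s (n * n * 700) (fun s' => exists2 t',
    level_state s' k t' & forall x, tcov t' x = k).
Proof.
move=> n0 k1 ls; have [ctx kE wE st pt] := ls.
apply: (@runs_seq _ _ _ _ _
  (n * (n * 100 + 100) + 20) (n * (n * 160 + 240) + 20)).
  by nia.
have rE : D * rmem s rScale 0 = radius k by rewrite wE.
apply: runs_weaken (runs_ball_masses ctx rE) => // s1 [mE so1].
have ls1 : level_state s1 k t by apply: level_state_off so1 ls.
apply: (@runs_for _ _ _ _ _ (n * 160 + 220) n (fun i s' => exists2 t',
  level_state s' k t' & (#|[pred y | tcov t' y < k]| <= n - i)%N)).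
- by lia.
- by case: ls1 => [[[]]].
- by [].
- by [].
- by [].
- exists t; last by rewrite subn0 -[leqRHS]card_ord max_card.
  apply: (@level_state_off [:: vI] [::] s1) => //.
  by split=> // a al; exact: upd_off al.
- move=> i s2 i_n so2 iE [t2 ls2 c2].
  have mE2 x : rmem s2 rMass x = ball_mass x (radius k) by rewrite so2.2.
  apply: runs_weaken (runs_net_round k1 ls2 mE2) => // s3 [t3 [ls3 c3 _]].
  exists t3; last by move: c3 c2; lia.
  apply: (@level_state_off [:: vI] [::] s3) => //.
  by split=> // a al; exact: upd_off al.
- move=> s' [t' ls' c'] _; exists t' => // x.
  have [_ _ _ _ pt'] := ls'; have [_ bnd _ _ _ _] := pt'.
  have [cx _ _] := bnd x; apply/eqP; rewrite eqn_leq cx leqNgt.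
  apply/negP => ux; move: c'; rewrite subnn leqn0 => /eqP/card0_eq/(_ x).
  by rewrite !inE ux.
Qed.

End Program.

Section Main.
Variables (R : realType) (h : R -> R) (n : nat).
Variables (d : 'I_n -> 'I_n -> R) (rho : 'I_n -> R).
Hypotheses (d_metric : is_metric d) (rho_prob : is_probability rho).
Variable z : 'I_n.
Hypothesis z0 : z = 0%N :> nat.

Lemma has_input_input : has_input d rho (input d rho).
Proof.
split=> [|i j|i] //=.
- rewrite (bigD1 i)//= [X in X + _](bigD1 j)//= !big1 ?addr0//.
    move=> i' i'i; rewrite big1// => j' /eqP e; case/negP: i'i.
    have n0 : (0 < n)%N by exact: leq_trans (ltn_ord i).
    have h1 : ((i * n + j) %/ n)%N = i by rewrite divnMDl ?divn_small ?addn0.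
    have h2 : ((i' * n + j') %/ n)%N = i' by rewrite divnMDl ?divn_small ?addn0.
    by apply/eqP/val_inj; rewrite /= -h1 e h2.
  move=> j' /andP[/eqP/addnI e] /negP; case.
  by apply/eqP/val_inj.
- rewrite (bigD1 i)//= big1 ?addr0// => i' /andP[/eqP e] /negP; case.
  by apply/eqP/val_inj.
Qed.

Lemma runs_measure_input s : has_input d rho s -> rmem s rSize 0 = 0 ->
  rmem s rDiam 0 = 0 ->
  runs h measure_input s (n * 60 + 20) (fun s' => exists D,
    [/\ has_context d rho D s', 0 <= D, forall x, d z x <= D,
        exists x, d z x = D & same_off [:: vJ] [:: rSize; rDiam] s s']).
Proof.
have [dp d0 _ _] := d_metric.
move=> hi s0 sd0.
apply: (@runs_for _ _ _ _ _ 40 n (fun j s' => rmem s' rSize 0 = j%:R /\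
  exists D, [/\ rmem s' rDiam 0 = D, 0 <= D,
    forall x : 'I_n, (x < j)%N -> d z x <= D & exists x, d z x = D])) => //.
- by case: hi.
- split=> //; exists 0; split=> //; exists z; exact/d0.
- move=> j s1 j_n so jE [sE [D [DE D0 Dx [x xD]]]].
  have hi1 : has_input d rho s1 by apply: has_input_off so hi.
  apply: (@runs_seq _ _ _ _ _ 10 30) => //; apply: runs_setr => //=.
  rewrite sE natr1.
  have jd : rmem s1 rDist j = d z (Ordinal j_n).
    by rewrite -(input_dist hi1) z0 mul0n add0n.
  apply: runs_if => //=;
    rewrite upd_other// DE (upd_other (rmem s1))// jE jd => Dj.
    apply: runs_setr => //=.
    rewrite (@upd_other _ (rmem s1) _ _ _ rDist)// jE jd.
    split; first by rewrite upd_other// upd_same.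
    exists (d z (Ordinal j_n)); split=> //.
    + move=> y; rewrite ltnS leq_eqVlt => /predU1P[yj|yj].
        by have -> : y = Ordinal j_n by exact: val_inj.
      by apply: le_trans Dj; exact: Dx.
    + by exists (Ordinal j_n).
  apply: runs_skip => //=; split; first by rewrite upd_same.
  exists D; split=> //.
  + move=> y; rewrite ltnS leq_eqVlt => /predU1P[yj|yj]; last exact: Dx.
    have -> : y = Ordinal j_n by exact: val_inj.
    by apply: ltW; rewrite ltNge.
  + by exists x.
- move=> s' [sE [D [DE D0 Dx xD]]] so; exists D.
  split=> //; last by move=> x; exact: Dx.
  by split=> //; exact: has_input_off so hi.
Qed.

Let L := (up_log 8 n).+2.

(** The loop runs [up_log 8 n] times, since the test before iteration i, counted
    from 0, asks whether 8^i < n; the level of the last pass is therefore [L]. *)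
Lemma runs_tree_program :
  runs h tree_program (input d rho) ((up_log 8 n).+2 * (n * n * 1000))
    (fun s => exists D t, [/\ has_context d rho D s, 0 <= D,
      forall x, d z x <= D, exists x, d z x = D & stores d rho D L z s t /\
      hierarchy d rho D L z (tlev t) (tpar t) /\ imem s aRoot 0 = 0%N]).
Proof.
have n0 : (0 < n)%N by exact: leq_trans (ltn_ord z).
have nR0 : 0 < n%:R :> R by rewrite ltr0n.
pose N := up_log 8 n.
have nn : (n <= n * n)%N by rewrite leq_pmull.
have nn0 : (0 < n * n)%N by rewrite muln_gt0 n0.
suff H : runs h tree_program (input d rho) ((up_log 8 n).+2 * (n * n * 1000))
    (fun s => exists D t, [/\ has_context d rho D s, 0 <= D,
      forall x, d z x <= D, exists x, d z x = D & stores d rho D L z s t /\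
      hierarchy d rho D L z (tlev t) (tpar t)]).
  apply: runs_weaken (runs_frame H) => // s [[D [t [h1 h2 h3 h4 [h5 h6]]]] so].
  by exists D, t; split=> //; split=> //; split=> //; rewrite so.1.
apply: (@runs_seq _ _ _ _ _ (n * 60 + 20) ((N + 1) * (n * n * 800) + 100)).
  by rewrite -/N; nia.
apply: runs_weaken (runs_measure_input has_input_input _ _) => // s1.
move=> [D [ctx1 D0 Dx Dex so1]].
apply: (@runs_seq _ _ _ _ _ 10 ((N + 1) * (n * n * 800) + 90)); first by lia.
apply: runs_seti => //=.
apply: (@runs_seq _ _ _ _ _ 10 ((N + 1) * (n * n * 800) + 80)); first by lia.
apply: runs_seti => //=.
apply: (@runs_seq _ _ _ _ _ 10 ((N + 1) * (n * n * 800) + 70)); first by lia.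
apply: runs_setr => //=; rewrite mul1r.
set s2 := State _ _.
have so2 : same_off [:: aLev; vK] [:: rScale] s1 s2.
  split=> a al; rewrite /=; last by apply: upd_off al.
  by rewrite (upd_off _ _ _ _ al) ?(upd_off _ _ _ _ al) ?inE.
have ctx2 : has_context d rho D s2 by apply: has_context_off so2 ctx1.
pose t0 := Tables (fun x : 'I_n => if x == z then 1%N else 0%N) (fun _ => 0%N)
  (fun _ => z) id.
have st2 : stores d rho D L z s2 t0.
  split=> x /=.
  - rewrite upd_other// /upd /= so1.1//= -(inj_eq val_inj) /= z0.
    by case: eqP.
  - by rewrite /upd /= so1.1.
  - by rewrite /upd /= so1.1.
  - by move=> /negbTE ->.
have pt2 : partial_hierarchy d rho D L z 2 t0.
  apply: partial_init => //=; first by rewrite eqxx.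
  by move=> x /negbTE ->.
apply: (@runs_seq _ _ _ _ _
  (N * (n * n * 700 + 40 + 20) + 20) (n * n * 700 + 10)).
  by nia.
(* The scale of level [i.+2] is still to be used when [i] levels are done. *)
pose Inv i s := exists t, [/\ has_context d rho D s, imem s vK 0 = i.+2,
  rmem s rScale 0 = 8^-1 ^+ i.+1, stores d rho D L z s t
  & partial_hierarchy d rho D L z i.+2 t].
apply: (@runs_weaken _ _ _ _ (N * ((n * n * 700 + 40) + 11) + 11) _ (Inv N)).
- by nia.
- move=> s [t [ctx kE wE st pt]].
  apply: (@runs_seq _ _ _ _ _ 10 (n * n * 700)); first by lia.
  apply: runs_setr => //=.
  set s3 := State _ _.
  have so3 : same_off [::] [:: rScale] s s3.
    by split=> // a al; exact: upd_off al.
  have ls : level_state d rho D L z s3 L t.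
    split=> //.
    + exact: has_context_off so3 ctx.
    + by rewrite /= upd_same scaleL.
    + exact: stores_off so3 st.
  apply: runs_weaken (runs_build_level h d_metric rho_prob z0 D0 n0 _ ls) => //.
  move=> s4 [t4 [ctx4 kE4 wE4 st4 pt4] full].
  exists D, t4; split=> //; split=> //.
  exact: partial_complete pt4 _ full.
- apply: (@runs_while _ _ _ _ _ (n * n * 700 + 40) N Inv).
  - by exists t0; split.
  - move=> i s iN [t [ctx kE wE st pt]].
    have w8 : 8 * 8^-1 ^+ i.+1 = (8 ^+ i)^-1 :> R.
      by rewrite exprS mulrA divff ?mul1r ?exprVn.
    split.
      rewrite /= wE (context_size ctx) w8 -ltNge mulrC.
      rewrite ltr_pdivlMr ?exprn_gt0// mul1r -natrX ltr_nat ltnNge.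
      apply/negP => /(up_log_min (isT : (1 < 8)%N)).
      by rewrite -/N leqNgt iN.
    have ls : level_state d rho D L z s i.+2 t.
      by split=> //; rewrite wE scale_ltL.
    apply: (@runs_seq _ _ _ _ _ (n * n * 700) 40); first by lia.
    apply: runs_weaken
      (runs_build_level h d_metric rho_prob z0 D0 n0 _ ls) => //.
    move=> s3 [t3 [ctx3 kE3 wE3 st3 pt3] full].
    apply: (@runs_seq _ _ _ _ _ 20 20) => //; apply: runs_setr => //=.
    apply: runs_seti => //=.
    exists t3; split.
    + apply: (@has_context_off _ _ _ _ _ [:: vK] [:: rScale] s3) => //.
      by split=> a al; exact: upd_off al.
    + by rewrite /= upd_same kE3 addn1.
    + by rewrite /= upd_same wE3 scale_ltL//= -exprSr.
    + apply: (@stores_off _ _ _ _ _ _ _ [:: vK] [:: rScale] s3) => //.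
      by split=> a al; exact: upd_off al.
    + exact: partial_next.
  - move=> s [t [ctx kE wE st pt]].
    have w8 : 8 * 8^-1 ^+ N.+1 = (8 ^+ N)^-1 :> R.
      by rewrite exprS mulrA divff ?mul1r ?exprVn.
    rewrite /= negbK wE (context_size ctx) w8 mulrC.
    by rewrite ler_pdivrMr ?exprn_gt0// mul1r -natrX ler_nat up_logP.
Qed.

End Main.

(** * Output, running time and conclusion *)

Lemma output_parent_tree (R : realType) n (s : state R) (z : 'I_n)
    (lev : 'I_n -> nat) (par : 'I_n -> 'I_n) (lab : 'I_n -> R) :
  z = 0%N :> nat -> (forall x, x != z -> (lev (par x) < lev x)%N) ->
  imem s 1 0 = 0%N ->
  (forall x : 'I_n, x != z -> [/\ imem s 2 x.-1 = x, imem s 3 x.-1 = par x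
    & rmem s 2 x.-1 = lab x]) ->
  output s (parent_tree z par lab).
Proof.
move=> z0 par_lev s1 edge; split; first by rewrite s1 /= z0.
have lt_n (k : 'I_n.-1) : (k.+1 < n)%N by have := ltn_ord k; lia.
pose u k := Ordinal (lt_n k).
have uz k : u k != z by rewrite -(inj_eq val_inj) /= z0.
exists u, (fun k => par (u k)); split.
- by move=> k; have [e1 e2 _] := edge _ (uz k).
- apply/setP => e; apply/imsetP/imsetP => [[x]|[k _ ->]]; last first.
    by exists (u k); rewrite ?inE.
  rewrite inE => xz ->.
  have x0 : (0 < x)%N.
    rewrite lt0n; apply: contraNneq xz => x0.
    by apply/eqP/val_inj; rewrite /= x0 z0.
  have xn : (x.-1 < n.-1)%N by have := ltn_ord x; lia.
  exists (Ordinal xn) => //.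
  have <- : x = u (Ordinal xn) by apply: val_inj; rewrite /= prednK.
  by [].
- move=> k; have [_ _ e3] := edge _ (uz k).
  rewrite -[X in label _ X]/(parent_edge par (u k)).
  by rewrite (label_parent_edge _ par_lev).
Qed.

(** From 8 ^ (up_log 8 n).-1 < n, with ln 8 = 3 ln 2 > 1 and ln n > 1/2. *)
Lemma up_log_le_ln (R : realType) n : (2 <= n)%N ->
  (up_log 8 n)%:R + 2 <= 7 * ln (n%:R : R).
Proof.
move=> n2; have n0 : 0 < n%:R :> R by rewrite ltr0n ltnW.
have ln2 : 1 / 2 <= ln (2 : R).
  have := @le_ln1Dx R (- (1 / 2)) _; have -> : 1 + - (1 / 2) = 2^-1 :> R by lra.
  by rewrite lnV ?posrE//; lra.
have lnn : 1 / 2 <= ln (n%:R : R).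
  by apply: le_trans ln2 _; rewrite ler_ln ?posrE// ler_nat.
have /andP[lo _] := up_log_bounds (isT : (1 < 8)%N) n2.
have : ln ((8 ^ (up_log 8 n).-1)%:R : R) <= ln (n%:R : R).
  by rewrite ler_ln ?posrE// ?ltr0n ?expn_gt0// ler_nat ltnW.
have -> : (8 ^ (up_log 8 n).-1 = 2 ^ (3 * (up_log 8 n).-1))%N by rewrite expnM.
rewrite natrX lnXn// => H.
have : (3 * (up_log 8 n).-1)%:R * (1 / 2) <=
    ln (2 : R) *+ (3 * (up_log 8 n).-1).
  by rewrite -[leRHS]mulr_natl ler_wpM2l.
have : (up_log 8 n)%:R <= (up_log 8 n).-1%:R + 1 :> R.
  by rewrite natr1 ler_nat leqSpred.
rewrite natrM; have : 0 <= (up_log 8 n).-1%:R :> R by [].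
lra.
Qed.

Theorem theorem1p8 (R : realType) :
  exists (c K : R) (alg : cmd), 0 < c /\
    forall h : R -> R,
      log_concave_chaining_functional h ->
      (exists2 l : R, has_left_derivative h 1 l & `|l| = 1) ->
    forall (n : nat) (d : 'I_n -> 'I_n -> R) (rho : 'I_n -> R),
      is_metric d -> is_probability rho ->
    exists (t : nat) (s : state R) (C : labelled_graph R 'I_n),
      [/\ exec h alg (input d rho) t s,
          (2 <= n)%N -> t%:R <= K * (n%:R ^+ 2 * ln n%:R),
          output s C,
          is_chaining_tree C
        & ((val_h h d C)%:E <= c%:E * gamma_h h d rho)%E].
Proof.
exists (37 + 128 * 8), (1000 * 7), tree_program; split; first by lra.
move=> h h_lc h_norm n d rho d_metric rho_prob.
have n0 : (0 < n)%N.
  case: n d rho d_metric rho_prob => // d rho _ [_].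
  by rewrite big_ord0 => /esym/eqP; rewrite oner_eq0.
pose z : 'I_n := Ordinal n0.
have z0 : z = 0%N :> nat by [].
have [t [s [ex tT [D [tab [ctx D0 Dz [x xD] [st [hier root]]]]]]]] :=
  runs_tree_program h d_metric rho_prob z0.
have par_lev y : y != z -> (tlev tab (tpar tab y) < tlev tab y)%N.
  by move=> yz; have [/andP[]] := parent_link hier yz.
have last_scale : scale R (up_log 8 n).+2 (up_log 8 n).+1 * #|'I_n|%:R <= 1.
  rewrite card_ord scale_ltL//= exprVn mulrC ler_pdivrMr ?exprn_gt0// mul1r.
  by rewrite -natrX ler_nat up_logP.
exists t, s, (parent_tree z (tpar tab)
  (tree_label d rho D (up_log 8 n).+2 (tlev tab))).
split=> //.
- move=> n2; apply: (@le_trans _ _ ((up_log 8 n).+2 * (n * n * 1000))%:R).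
    by rewrite ler_nat.
  have expand a m : (a.+2 * (n * n * m))%:R =
      (a%:R + 2) * (n%:R * n%:R * m%:R) :> R.
    by rewrite -addn2 natrM natrD !natrM.
  rewrite expand expr2; have n20 : 0 <= n%:R * n%:R :> R by rewrite mulr_ge0.
  by have := ler_wpM2r n20 (up_log_le_ln R n2); lra.
- apply: (output_parent_tree (lev := tlev tab)) => // y yz.
  by apply: (stores_edge st) => //; have /andP[/ltnW] := level_bounds hier yz.
- exact: (chaining_tree_hierarchy d_metric rho_prob hier).
- apply: (val_le_gamma d_metric rho_prob h_lc h_norm D0 _ last_scale hier)
  => //.
  rewrite -xD; exact: (dist_le_gamma d_metric rho_prob h_lc h_norm).
Qed.
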